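(* Let $\Lambda^\vee$ be obtained from $\Lambda$ by switching the $+$ and $-$ boxes. If $\tau\in\mathcal{PP}(p,q)$ corresponds to the triple $(\Lambda,\mathsf Q,\mathsf P)$ under the bijection $$\mathcal{PP}(p,q)\to\bigsqcup_{\Lambda\in ASYD(q,p)}SYT(\Lambda^+)\times SYT(\Lambda^-),$$ then the dual partial permutation $\tau^\vee\in\mathcal{PP}(q,p)$ corresponds to the triple $(\Lambda^\vee,\mathsf P,\mathsf Q)$ (under the analogous bijection for $\mathcal{PP}(q,p)$).
   Context: Everything is over $\mathbb C$; $p,q$ are positive integers. Partitions and tableaux. A partition $\lambda$ is a weakly decreasing sequence $(\lambda(1),\lambda(2),\dots)$ of positive integers (zero beyond its length), identified with its Young diagram; $(\nu+\lambda)(i)=\nu(i)+\lambda(i)$. $J(x)$ is the partition of Jordan block sizes of a nilpotent $x$. $SYT(\lambda)$ is the set of standard Young tableaux of shape $\lambda$, viewed as chains of partitions $(\mathsf T(1);\dots;\mathsf T(n)=\lambda)$, $|\mathsf T(i)|=i$, $\mathsf T(i)\subset\mathsf T(i+1)$. If $x$ is nilpotent on an $n$-dimensional space and $F_\bullet$ a full flag with $xF_i\subset F_{i-1}$ for all $i$, then $\mathrm{Tab}(x,F_\bullet)=(J(x|F_1);\dots;J(x|F_n))$. Signed Young diagrams. A $\pm$-filling of a Young diagram assigns $+$ or $-$ to each box so that adjacent boxes in the same row have opposite signs. Two $\pm$-fillings are equivalent if they differ by a permutation of rows of equal size; a signed Young diagram is an equivalence class. $SYD(q,p)$ is the set of those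 with $q$ boxes $+$ and $p$ boxes $-$; $\mathrm{sh}(\Lambda)$ is the underlying partition. $\Lambda^+$ (resp. $\Lambda^-$) is the partition obtained by removing all $-$ (resp. $+$) boxes and rearranging rows into weakly decreasing order. $\Lambda$ is admissible if $\mathrm{sh}(\Lambda)=\Lambda^++\Lambda^-$; $ASYD(q,p)$ is the set of admissible ones. The bijection. $\mathcal{PP}(p,q)$ is the set of $p\times q$ matrices with entries in $\{0,1\}$ having at most one nonzero entry in each row and column. Let $\dim V_q=q$, $\dim V_p=p$, $H=\mathrm{Hom}(V_q,V_p)$, $H^\vee=\mathrm{Hom}(V_p,V_q)$, $K=GL(V_q)\times GL(V_p)$, $T^*H=H\times H^\vee$ via the trace pairing, $\mathcal O=\{(x,y)\in H\times H^\vee:xy\text{ nilpotent}\}$. For $(x,y)\in\mathcal O$, give $V_q$ degree $+$ and $V_p$ degree $-$; $V_q\oplus V_p$ is a direct sum of strings, i.e. subspaces with basis of homogeneous vectors $v_1,\dots,v_k$, where $v_{j+1}$ is the image of $v_j$ under $x$ (if $v_j\in V_q$) or $y$ (if $v_j\in V_p$) and $v_k$ is sent to $0$; each string contributes a row of $k$ boxes whose signs read from right to left are the degrees of $v_1,\dots,v_k$. This gives $\Lambda\in SYD(q,p)$; $\mathcal O(\Lambda)$ is the set (a $K$-orbit) of pairs with diagram $\Lambda$. Let $X_q,X_p$ be the full flag varieties of $V_q,V_p$, $X=X_q\times X_p$, $C=X\times H$; let $C(\tau)=\{(E_\bullet,F_\bullet,x)\in C:\dim(xE_i+F_j)=j+\sum_{l\le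 i}\sum_{k>j}\tau_{kl}\ \forall i,j\}$, $\tau\in\mathcal{PP}(p,q)$ (the $K$-orbits in $C$), with conormal bundle $Z_C(\tau)=T^*_CC(\tau)=\{(E_\bullet,F_\bullet,x,y): (E_\bullet,F_\bullet,x)\in C(\tau),\ (x,y)\in\mathcal O,\ yxE_i\subset E_{i-1},\ xyF_i\subset F_{i-1}\ \forall i\}$. Let $\mathrm{pr}(\tau)$ be the unique $\Lambda\in SYD(q,p)$ such that the image of $\overline{Z_C(\tau)}$ under $(E_\bullet,F_\bullet,x,y)\mapsto(x,y)$ is $\overline{\mathcal O(\Lambda)}$. The bijection sends $\tau$ to $(\Lambda,\mathsf Q,\mathsf P)=(\mathrm{pr}(\tau),\mathrm{Tab}(yx,E_\bullet),\mathrm{Tab}(xy,F_\bullet))$ for $(E_\bullet,F_\bullet,x,y)$ in a suitable dense open subset of $Z_C(\tau)$. The bijection for $\mathcal{PP}(q,p)$ is the same construction with the roles of $V_q$ and $V_p$ exchanged (so the source space $V_p$ of $H^\vee=\mathrm{Hom}(V_p,V_q)$ has degree $+$ and $V_q$ has degree $-$); it takes values in $\bigsqcup_{\Lambda'\in ASYD(p,q)}SYT(\Lambda'^+)\times SYT(\Lambda'^-)$. The dual $\tau^\vee$. Fix $(E_\bullet,F_\bullet)\in X$ and let $B_K=\mathrm{Stab}_K(E_\bullet,F_\bullet)$. For $\tau\in\mathcal{PP}(p,q)$, the matrix Schubert fibre $H(\tau)\subset H$ is the fibre of $C(\tau)\to X$ over $(E_\bullet,F_\bullet)$; the $H(\tau)$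 are the $B_K$-orbits in $H$. Likewise, the $B_K$-orbits in $H^\vee$ are $H^\vee(\sigma)=\{y\in H^\vee:\dim(yF_i+E_j)=j+\sum_{l\le i}\sum_{k>j}\sigma_{kl}\ \forall i,j\}$, $\sigma\in\mathcal{PP}(q,p)$. Let $T^*_HH(\tau)\subset T^*H=H\times H^\vee$ be the conormal bundle of $H(\tau)$ in $H$ and $\pi:H\times H^\vee\to H^\vee$ the projection. Then $\pi(\overline{T^*_HH(\tau)})$ is the closure of a single $B_K$-orbit in $H^\vee$, and $\tau^\vee\in\mathcal{PP}(q,p)$ is defined by $\pi(\overline{T^*_HH(\tau)})=\overline{H^\vee(\tau^\vee)}$; equivalently the projectivizations of $\overline{H(\tau)}$ and $\overline{H^\vee(\tau^\vee)}$ are projectively dual. *)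

(* Defs.v *)
From HB Require Import structures.
From mathcomp Require Import all_boot all_order all_algebra.
From mathcomp Require Import boolp classical_sets reals.
From mathcomp Require Export complex mpoly.

Set Implicit Arguments.
Unset Strict Implicit.
Unset Printing Implicit Defensive.

Import GRing.Theory.
Local Open Scope ring_scope.
Local Open Scope classical_set_scope.
Local Open Scope quotient_scope.

(** * Partitions and standard tableaux *)

Definition is_part (la : seq nat) : bool := sorted geq la && (0%N \notin la).

Definition part_le (nu la : seq nat) : bool :=
  [forall i : 'I_(size nu), (nth 0%N nu i <= nth 0%N la i)%N].

Definition part_add (nu la : seq nat) : seq nat :=
  mkseq (fun i => (nth 0 nu i + nth 0 la i)%N) (maxn (size nu) (size la)).

(* [T] is the chain T(1), ..., T(n) : its entry of index i is T(i+1). *)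
Definition is_SYT (la : seq nat) (T : seq (seq nat)) : Prop :=
  [/\ size T = sumn la,
      last [::] T = la,
      all is_part T,
      forall i : nat, (i < size T)%N -> sumn (nth [::] T i) = i.+1
    & sorted part_le T].

(** * Signed Young diagrams *)

(* A row is the list of its signs from left to right, [true] being +. *)
Definition is_filling (s : seq (seq bool)) : bool :=
  [&& is_part (map size s) & all (sorted (fun a b => a != b)) s].

Definition filling := {s : seq (seq bool) | is_filling s}.

(* The row lengths of a filling are sorted, so two fillings have the same rows
   up to order iff they differ by a permutation of rows of equal size. *)
Definition filling_equiv (s t : filling) : bool := perm_eq (val s) (val t).

Lemma filling_equiv_refl : reflexive filling_equiv.
Proof. by move=> s; exact: perm_refl. Qed.

Lemma filling_equiv_sym : ssrbool.symmetric filling_equiv.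
Proof. by move=> s t; exact: perm_sym. Qed.

Lemma filling_equiv_trans : transitive filling_equiv.
Proof. by move=> t s u; exact: perm_trans. Qed.

Canonical filling_equivrel := EquivRel filling_equiv
  filling_equiv_refl filling_equiv_sym filling_equiv_trans.

Definition signed_diagram := {eq_quot filling_equiv}.

Definition rows (L : signed_diagram) : seq (seq bool) := val (repr L).

Lemma rows_pi (s : filling) : perm_eq (rows (\pi_signed_diagram s)) (val s).
Proof.
have /eqmodP : repr (\pi_signed_diagram s) = s %[mod signed_diagram].
  by rewrite reprK.
by [].
Qed.

Definition nb_boxes (b : bool) (L : signed_diagram) : nat :=
  sumn [seq count_mem b r | r <- rows L].

Definition sh (L : signed_diagram) : seq nat := map size (rows L).

(* [sign_part true L] and [sign_part false L] are $\Lambda^+$, $\Lambda^-$. *)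
Definition sign_part (b : bool) (L : signed_diagram) : seq nat :=
  sort geq [seq k <- [seq count_mem b r | r <- rows L] | (0 < k)%N].

Definition in_SYD (q p : nat) (L : signed_diagram) : Prop :=
  nb_boxes true L = q /\ nb_boxes false L = p.

Definition admissible (L : signed_diagram) : Prop :=
  sh L = part_add (sign_part true L) (sign_part false L).

Definition in_ASYD (q p : nat) (L : signed_diagram) : Prop :=
  in_SYD q p L /\ admissible L.

Definition switch_rows (s : seq (seq bool)) : seq (seq bool) :=
  map (map negb) s.

Lemma switch_filling_subproof (s : filling) : is_filling (switch_rows (val s)).
Proof.
case: s => s /= /andP[Hp Ha]; apply/andP; split.
  by rewrite -map_comp (eq_map (g := size)) // => r /=; rewrite size_map.
rewrite all_map; apply: sub_all Ha => r /=; rewrite sorted_map.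
by apply: sub_sorted => a b /=; case: a; case: b.
Qed.

Definition switch_filling (s : filling) : filling :=
  exist _ (switch_rows (val s)) (switch_filling_subproof s).

Definition syd_switch (L : signed_diagram) : signed_diagram :=
  \pi_signed_diagram (switch_filling (repr L)).

(** * Zariski topology of a finite-dimensional vector space *)

Definition coords {F : fieldType} {V : vectType F} (v : V) :
    'I_(\dim {: V}) -> F :=
  fun i => coord (vbasis {: V}) i v.

Definition zclosure {F : fieldType} {V : vectType F} (A : set V) : set V :=
  [set v | forall f : {mpoly F[\dim {: V}]},
     (forall a, A a -> f.@[coords a] = 0) -> f.@[coords v] = 0].

(* Common zeros of the differentials at [a] of the functions vanishing on [A];
   for [a] in a locally closed [A] this is the tangent space of [A] at [a]. *)
Definition tangent {F : fieldType} {V : vectType F} (A : set V) (a : V) :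
    set V :=
  [set v | forall f : {mpoly F[\dim {: V}]},
     (forall b, A b -> f.@[coords b] = 0) ->
     \sum_i (f^`M(i)).@[coords a] * coords v i = 0].

(** * Strings and Jordan types *)

Definition strings {T : Type} (f : T -> T) (vs : seq T) (ks : seq nat) :
    seq T :=
  flatten [seq traject f vk.1 vk.2 | vk <- zip vs ks].

(* [f], restricted to the subspace [W], is nilpotent with Jordan block sizes
   [la]. *)
Definition jordan_type {F : fieldType} {V : vectType F} (f : V -> V)
    (W : {vspace V}) (la : seq nat) : Prop :=
  is_part la /\
  exists vs : seq V,
    [/\ size vs = size la,
        basis_of W (strings f vs la)
      & forall i, (i < size la)%N -> iter (nth 0%N la i) f (nth 0 vs i) = 0].

(* [x] and [y] act on V_q (+) V_p, on columns. *)
Definition step {F : fieldType} {q p : nat} (x : 'M[F]_(p, q))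
    (y : 'M[F]_(q, p)) (w : 'cV[F]_q * 'cV[F]_p) : 'cV[F]_q * 'cV[F]_p :=
  (y *m w.2, x *m w.1).

Definition homogeneous {F : fieldType} {q p : nat} (b : bool)
    (w : 'cV[F]_q * 'cV[F]_p) : Prop :=
  if b then w.2 = 0 else w.1 = 0.

(* The signs of a row, read from right to left, are the degrees of the
   successive vectors of its string. *)
Definition has_diagram {F : fieldType} {q p : nat} (x : 'M[F]_(p, q))
    (y : 'M[F]_(q, p)) (L : signed_diagram) : Prop :=
  exists vs : seq ('cV[F]_q * 'cV[F]_p)%type,
    [/\ size vs = size (rows L),
        basis_of fullv (strings (step x y) vs (sh L))
      & forall i, (i < size (rows L))%N ->
          let r := nth [::] (rows L) i in
          let v := nth (0, 0) vs i in
          iter (size r) (step x y) v = (0, 0) /\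
          forall j, (j < size r)%N ->
            homogeneous (nth true (rev r) j) (iter j (step x y) v)].

Definition nilcone {F : fieldType} {q p : nat} :
    set ('M[F]_(p, q) * 'M[F]_(q, p)) :=
  [set z | exists k : nat, (z.1 *m z.2) ^+ k = 0].

Definition orbit_O {F : fieldType} {q p : nat} (L : signed_diagram) :
    set ('M[F]_(p, q) * 'M[F]_(q, p)) :=
  [set z | nilcone z /\ has_diagram z.1 z.2 L].

(** * Full flags *)

(* E_i is indexed by all naturals, with E_i the whole space for i >= n. *)
Record flag (F : fieldType) (n : nat) := Flag {
  fspace :> nat -> {vspace 'cV[F]_n};
  _ : forall i, \dim (fspace i) = minn i n;
  _ : forall i, (fspace i <= fspace i.+1)%VS
}.

Definition frame {F : fieldType} {n : nat} (g : 'M[F]_n) (E : flag F n) :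
    Prop :=
  g \in unitmx /\
  forall i, E i = <<[seq col j g | j : 'I_n <- enum 'I_n & (j < i)%N]>>%VS.

Definition tab {F : fieldType} {n : nat} (a : 'M[F]_n) (E : flag F n)
    (T : seq (seq nat)) : Prop :=
  size T = n /\
  forall i, (i < n)%N -> jordan_type (mulmx a) (E i.+1) (nth [::] T i).

Definition img {F : fieldType} {m n : nat} (a : 'M[F]_(m, n))
    (U : {vspace 'cV[F]_n}) : {vspace 'cV[F]_m} :=
  (linfun (mulmx a) @: U)%VS.

(* Points of X x T^*H, written ((E, F), (x, y)). *)
Definition point (F : fieldType) (q p : nat) : Type :=
  ((flag F q * flag F p) * ('M[F]_(p, q) * 'M[F]_(q, p)))%type.

(* The topology on a flag variety is the quotient topology of GL_n -> GL_n/B,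
   which sends a matrix to the flag spanned by its first columns; this map
   being open, closures can be computed upstairs. *)
Definition frames {F : fieldType} {q p : nat} (A : set (point F q p)) :
    set (('M[F]_q * 'M[F]_p) * ('M[F]_(p, q) * 'M[F]_(q, p))) :=
  [set u | exists (E1 : flag F q) (E2 : flag F p),
     [/\ frame u.1.1 E1, frame u.1.2 E2 & A ((E1, E2), u.2)]].

Definition pclosure {F : fieldType} {q p : nat} (A : set (point F q p)) :
    set (point F q p) :=
  [set z | exists (g : 'M[F]_q) (h : 'M[F]_p),
     [/\ frame g z.1.1, frame h z.1.2 & zclosure (frames A) ((g, h), z.2)]].

Definition popen {F : fieldType} {q p : nat} (A : set (point F q p)) : Prop :=
  pclosure (~` A) `<=` ~` A.

Definition dense_open_in {F : fieldType} {q p : nat} (U Z : set (point F q p)) :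
    Prop :=
  (exists2 A, popen A & U = Z `&` A) /\ Z `<=` pclosure U.

(** * Partial permutations, Schubert cells and conormal bundles *)

Definition partial_perm {p q : nat} (tau : 'M[bool]_(p, q)) : Prop :=
  (forall k, (\sum_l tau k l <= 1)%N) /\ (forall l, (\sum_k tau k l <= 1)%N).

(* Rows and columns of [tau] are indexed from 0, hence the shifted bounds. *)
Definition schubert {F : fieldType} {q p : nat} (E1 : flag F q) (E2 : flag F p)
    (tau : 'M[bool]_(p, q)) : set 'M[F]_(p, q) :=
  [set x | forall i j, (i <= q)%N -> (j <= p)%N ->
     \dim (img x (E1 i) + E2 j)%VS =
       (j + \sum_(l < q | l < i) \sum_(k < p | j <= k) tau k l)%N].

(* The conormal bundle Z_C(tau) of C(tau) in C. *)
Definition conormal_C {F : fieldType} {q p : nat} (tau : 'M[bool]_(p, q)) :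
    set (point F q p) :=
  [set z | let: ((E1, E2), (x, y)) := z in
     [/\ schubert E1 E2 tau x,
         nilcone (x, y),
         forall i, (i < q)%N -> (img (y *m x) (E1 i.+1) <= E1 i)%VS
       & forall j, (j < p)%N -> (img (x *m y) (E2 j.+1) <= E2 j)%VS]].

(* The conormal bundle of [A] in Hom(V_q, V_p), inside Hom(V_q, V_p) x
   Hom(V_p, V_q) through the trace pairing. *)
Definition conormal {F : fieldType} {q p : nat} (A : set 'M[F]_(p, q)) :
    set ('M[F]_(p, q) * 'M[F]_(q, p)) :=
  [set z | A z.1 /\ forall v, tangent A z.1 v -> \tr (v *m z.2) = 0].

Definition is_pr {F : fieldType} {q p : nat} (tau : 'M[bool]_(p, q))
    (L : signed_diagram) : Prop :=
  in_SYD q p L /\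
  snd @` pclosure (@conormal_C F q p tau) = zclosure (@orbit_O F q p L).

(* The bijection sends [tau] to the triple (L, Q, P). The bijection for
   PP(q, p) is obtained by exchanging [p] and [q]. *)
Definition corresponds (F : fieldType) {q p : nat} (tau : 'M[bool]_(p, q))
    (L : signed_diagram) (Q P : seq (seq nat)) : Prop :=
  [/\ in_ASYD q p L,
      is_SYT (sign_part true L) Q,
      is_SYT (sign_part false L) P,
      @is_pr F q p tau L
    & exists2 U : set (point F q p), dense_open_in U (conormal_C tau) &
        forall E1 E2 x y, U ((E1, E2), (x, y)) ->
          tab (y *m x) E1 Q /\ tab (x *m y) E2 P].

Definition is_dual {F : fieldType} {q p : nat} (E1 : flag F q) (E2 : flag F p)
    (tau : 'M[bool]_(p, q)) (sigma : 'M[bool]_(q, p)) : Prop :=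
  snd @` zclosure (conormal (schubert E1 E2 tau)) =
  zclosure (schubert E2 E1 sigma).

(* Main.v *)
Require Import Defs.
From HB Require Import structures.
From mathcomp Require Import all_boot all_order all_algebra.
From mathcomp Require Import boolp classical_sets reals.

(* Both conormal bundles are subsets of one self-dual variety: identify
   [Z0 tau], the fibre of Z_C(tau) over the standard flags, with the pairs (x, y)
   such that x lies in the Schubert cell of tau and xy, yx are strictly upper
   triangular. It is also the conormal bundle of the cell, so duality says that
   for generic (x, y) in [Z0 tau] the matrix y lies in the cell of the dual
   sigma, that is (y, x) lies in [Z0 sigma]. The point is that such pairs are
   dense in [Z0 sigma] too; then the two conormal bundles have the same closure
   up to exchanging the factors, and all the data attached to generic points
   agree.

   Instead of comparing dimensions, we show that a polynomial g vanishing on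
   [Z0 tau] vanishes on [Z0 sigma]. At a generic (x, y) every direction (m, 0)
   tangent to the fibre of [Z0 sigma] over y is tangent to [Z0 tau]. Since the
   fibres over a cell have constant dimension, m extends to a polynomial vector
   field m(y), so the ideal of [Z0 tau] is stable under derivation along
   (m(y), 0). Hence all the derivatives of g along the fibre vanish at (x, y),
   and in characteristic zero g vanishes on the whole fibre. *)

Set Implicit Arguments.
Unset Strict Implicit.
Unset Printing Implicit Defensive.

Import GRing.Theory Num.Theory.
Local Open Scope ring_scope.
Local Open Scope classical_set_scope.

(** * Polynomial functions and curves *)

(** The tangency of (m, 0) is where duality does its work. Over the representative [pmx tau] the
    fibre of [Z0 tau] is a coordinate subspace, spanned by the uncovered positions, and it lies in
    the closure of the cell of sigma. Its directions are therefore tangent to that cell at a generic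
    y, and m, being conormal at y, has zero entries at the uncovered positions. These entries are
    the only obstruction to tangency to the cell of tau, so m lifts to a tangent vector (m, w) of
    [Z0 tau]. Since my and ym are already strictly upper triangular, differentiating the equations
    shows that w lies in the fibre over [pmx tau], and subtracting (0, w) leaves (m, 0).

    Smoothness and dimension theory are replaced by explicit polynomials: cells are orbits by
    Gaussian elimination, tangent vectors come from polynomial curves that may leave the set at the
    zeros of a determinant, and a generic point is one where a given polynomial does not vanish. For
    the tableaux, the open set attached to sigma must consist of points whose exchange lies in
    Z_C(tau); this forces a rank condition on x besides the given open set. *)

Section FunctionAlgebras.
Variables (F : fieldType) (T : Type).

(** The instances are the polynomial functions on a vector space, [polyfun], and on the line,
    [poly1fun]; stability under determinants, adjugates and evaluation is proved once for both. *)
Record subalgebra (A : set (T -> F)) : Prop := Subalgebra {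
  sub_cst : forall c, A (fun=> c);
  sub_add : forall f g, A f -> A g -> A (fun t => f t + g t);
  sub_mul : forall f g, A f -> A g -> A (fun t => f t * g t) }.

Definition mx_in (A : set (T -> F)) m n (M : T -> 'M[F]_(m, n)) : Prop :=
  forall i j, A (fun t => M t i j).

Definition map_in (A : set (T -> F)) (V : vectType F) (h : T -> V) : Prop :=
  forall i, A (fun t => coords (h t) i).

Variables (A : set (T -> F)) (subA : subalgebra A).

Lemma sub_opp f : A f -> A (fun t => - f t).
Proof.
move=> Af; have := sub_mul subA (sub_cst subA (-1)) Af.
by rewrite (_ : (fun t => -1 * f t) = (fun t => - f t)) //; apply/funext => t; rewrite mulN1r.
Qed.

Lemma sub_sum (I : Type) (r : seq I) (P : pred I) (f : I -> T -> F) :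
  (forall i, P i -> A (f i)) -> A (fun t => \sum_(i <- r | P i) f i t).
Proof.
move=> Af; elim: r => [|i r IH].
  rewrite (_ : (fun _ => _) = fun=> 0); first exact: sub_cst.
  by apply/funext => t; rewrite big_nil.
case Pi: (P i).
  rewrite (_ : (fun _ => _) = fun t => f i t + \sum_(i <- r | P i) f i t).
    by apply: sub_add => //; exact: Af.
  by apply/funext => t; rewrite big_cons Pi.
by rewrite (_ : (fun _ => _) = fun t => \sum_(i <- r | P i) f i t) //;
  apply/funext => t; rewrite big_cons Pi.
Qed.

Lemma sub_prod (I : Type) (r : seq I) (P : pred I) (f : I -> T -> F) :
  (forall i, P i -> A (f i)) -> A (fun t => \prod_(i <- r | P i) f i t).
Proof.
move=> Af; elim: r => [|i r IH].
  rewrite (_ : (fun _ => _) = fun=> 1); first exact: sub_cst.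
  by apply/funext => t; rewrite big_nil.
case Pi: (P i).
  rewrite (_ : (fun _ => _) = fun t => f i t * \prod_(i <- r | P i) f i t).
    by apply: sub_mul => //; exact: Af.
  by apply/funext => t; rewrite big_cons Pi.
by rewrite (_ : (fun _ => _) = fun t => \prod_(i <- r | P i) f i t) //;
  apply/funext => t; rewrite big_cons Pi.
Qed.

Lemma sub_exp f k : A f -> A (fun t => f t ^+ k).
Proof.
move=> Af; elim: k => [|k IH].
  rewrite (_ : (fun _ => _) = fun=> 1); first exact: sub_cst.
  by apply/funext => t; rewrite expr0.
rewrite (_ : (fun _ => _) = fun t => f t * f t ^+ k); first exact: sub_mul.
by apply/funext => t; rewrite exprS.
Qed.

Lemma sub_meval n (f : {mpoly F[n]}) (v : T -> 'I_n -> F) :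
  (forall i, A (v^~ i)) -> A (fun t => f.@[v t]).
Proof.
move=> Av; rewrite (_ : (fun _ => _) =
  fun t => \sum_(m <- msupp f) f@_m * \prod_i v t i ^+ m i); last first.
  by apply/funext => t; rewrite mevalE.
apply: sub_sum => m _; apply: sub_mul (sub_cst subA _) _ => //.
by apply: sub_prod => i _; exact: sub_exp.
Qed.

Lemma mx_in_cst m n (M : 'M[F]_(m, n)) : mx_in A (fun=> M).
Proof. by move=> i j; exact: sub_cst. Qed.

Lemma mx_in_add m n (M N : T -> 'M[F]_(m, n)) :
  mx_in A M -> mx_in A N -> mx_in A (fun t => M t + N t).
Proof.
move=> AM AN i j; have := sub_add subA (AM i j) (AN i j).
by congr A; apply/funext => t; rewrite mxE.
Qed.

Lemma mx_in_opp m n (M : T -> 'M[F]_(m, n)) :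
  mx_in A M -> mx_in A (fun t => - M t).
Proof.
by move=> AM i j; have := sub_opp (AM i j); congr A; apply/funext => t; rewrite mxE.
Qed.

Lemma mx_in_scale m n (f : T -> F) (M : T -> 'M[F]_(m, n)) :
  A f -> mx_in A M -> mx_in A (fun t => f t *: M t).
Proof.
move=> Af AM i j; have := sub_mul subA Af (AM i j).
by congr A; apply/funext => t; rewrite mxE.
Qed.

Lemma mx_in_mul m n k (M : T -> 'M[F]_(m, n)) (N : T -> 'M[F]_(n, k)) :
  mx_in A M -> mx_in A N -> mx_in A (fun t => M t *m N t).
Proof.
move=> AM AN i j; rewrite (_ : (fun _ => _) = fun t => \sum_l M t i l * N t l j).
  by apply: sub_sum => l _; exact: sub_mul.
by apply/funext => t; rewrite mxE.
Qed.

Lemma mx_in_block m1 m2 n1 n2 (M1 : T -> 'M[F]_(m1, n1)) (M2 : T -> 'M[F]_(m1, n2))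
    (M3 : T -> 'M[F]_(m2, n1)) (M4 : T -> 'M[F]_(m2, n2)) :
  mx_in A M1 -> mx_in A M2 -> mx_in A M3 -> mx_in A M4 ->
  mx_in A (fun t => block_mx (M1 t) (M2 t) (M3 t) (M4 t)).
Proof.
move=> A1 A2 A3 A4 i j.
case: (split_ordP i) => i' ->; case: (split_ordP j) => j' ->.
- by under eq_fun do rewrite block_mxEul; exact: A1.
- by under eq_fun do rewrite block_mxEur; exact: A2.
- by under eq_fun do rewrite block_mxEdl; exact: A3.
- by under eq_fun do rewrite block_mxEdr; exact: A4.
Qed.

Lemma sub_det n (M : T -> 'M[F]_n) : mx_in A M -> A (fun t => \det (M t)).
Proof.
move=> AM; rewrite /determinant; apply: sub_sum => s _.
by apply: sub_mul (sub_cst subA _) _ => //; apply: sub_prod.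
Qed.

Lemma mx_in_adj n (M : T -> 'M[F]_n) : mx_in A M -> mx_in A (fun t => \adj (M t)).
Proof.
move=> AM i j; rewrite (_ : (fun _ => _) =
   fun t => (-1) ^+ (j + i) * \det (row' j (col' i (M t)))); last first.
  by apply/funext => t; rewrite mxE.
apply: sub_mul (sub_cst subA _) _ => //; apply: sub_det => a b.
rewrite (_ : (fun _ => _) = fun t => M t (lift j a) (lift i b)); first exact: AM.
by apply/funext => t; rewrite !mxE.
Qed.

Lemma map_in_sum (V : vectType F) (I : finType) (f : I -> T -> F) (w : I -> V) :
  (forall k, A (f k)) -> map_in A (fun t => \sum_k f k t *: w k).
Proof.
move=> Af i; rewrite (_ : (fun _ => _) = fun t => \sum_k f k t * coords (w k) i).
  by apply: sub_sum => k _; apply: sub_mul => //; exact: sub_cst.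
by apply/funext => t; rewrite /coords linear_sum; apply: eq_bigr => k _; rewrite linearZ.
Qed.

Lemma coordsK (V : vectType F) (v : V) :
  v = \sum_i coords v i *: (vbasis {:V})`_i.
Proof. exact: (coord_vbasis (memvf v)). Qed.

Lemma map_in_linear (V W : vectType F) (h : T -> V) (u : V -> W) :
  linear u -> map_in A h -> map_in A (fun t => u (h t)).
Proof.
move=> lu Ah; pose ul := GRing.isLinear.Build _ _ _ _ _ lu.
pose uL : {linear V -> W} := HB.pack u ul.
rewrite (_ : (fun _ => _) = fun t => \sum_i coords (h t) i *: uL (vbasis {:V})`_i).
  exact: map_in_sum.
by apply/funext => t; rewrite {1}[h t]coordsK -[u]/(uL : _ -> _) linear_sum;
  apply: eq_bigr => i _; rewrite linearZ.
Qed.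

Lemma map_in_add (V : vectType F) (h k : T -> V) :
  map_in A h -> map_in A k -> map_in A (fun t => h t + k t).
Proof.
move=> Ah Ak i; have := sub_add subA (Ah i) (Ak i).
by congr A; apply/funext => t; rewrite /coords linearD.
Qed.

Lemma map_in_cst (V : vectType F) (v : V) : map_in A (fun=> v).
Proof. by move=> i; exact: sub_cst. Qed.

Lemma map_in_pair (V W : vectType F) (h : T -> V) (k : T -> W) :
  map_in A h -> map_in A k -> map_in A (fun t => (h t, k t)).
Proof.
move=> Ah Ak.
have l1 : linear (fun v : V => (v, 0 : W)).
  by move=> c u v; apply/pair_eqP; rewrite /= scaler0 addr0 !eqxx.
have l2 : linear (fun w : W => (0 : V, w)).
  by move=> c u v; apply/pair_eqP; rewrite /= scaler0 addr0 !eqxx.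
have := map_in_add (map_in_linear l1 Ah) (map_in_linear l2 Ak).
by congr map_in; apply/funext => t; apply/pair_eqP; rewrite /= addr0 add0r !eqxx.
Qed.

Lemma map_in_mx m n (M : T -> 'M[F]_(m, n)) : mx_in A M -> map_in A M.
Proof.
move=> AM.
have := map_in_sum (fun k : 'I_m * 'I_n => delta_mx k.1 k.2) (fun k => AM k.1 k.2).
congr map_in; apply/funext => t; rewrite {2}[M t]matrix_sum_delta pair_bigA.
by [].
Qed.

Lemma mx_in_map m n (M : T -> 'M[F]_(m, n)) : map_in A M -> mx_in A M.
Proof.
move=> AM i j; rewrite (_ : (fun _ => _) =
   fun t => \sum_k coords (M t) k * ((vbasis {:'M[F]_(m, n)})`_k : 'M_(m, n)) i j).
  by apply: sub_sum => k _; apply: sub_mul => //; exact: sub_cst.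
apply/funext => t; rewrite {1}[M t]coordsK summxE.
by apply: eq_bigr => k _; rewrite mxE.
Qed.

Lemma map_in_fst (V W : vectType F) (h : T -> V * W) :
  map_in A h -> map_in A (fun t => (h t).1).
Proof. exact: map_in_linear (@linearP _ _ _ _ (@fst V W)). Qed.

Lemma map_in_snd (V W : vectType F) (h : T -> V * W) :
  map_in A h -> map_in A (fun t => (h t).2).
Proof. exact: map_in_linear (@linearP _ _ _ _ (@snd V W)). Qed.

End FunctionAlgebras.

Section PolynomialFunctions.
Variable F : fieldType.

Definition polyfun (V : vectType F) : set (V -> F) :=
  [set f | exists g : {mpoly F[\dim {:V}]}, f = fun v => g.@[coords v]].

Definition poly1fun : set (F -> F) := [set f | exists p : {poly F}, f = horner p].

Lemma polyfun_subalgebra (V : vectType F) : subalgebra (@polyfun V).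
Proof.
split=> [c | _ _ [f ->] [g ->] | _ _ [f ->] [g ->]].
- by exists c%:MP; apply/funext => v; rewrite mevalC.
- by exists (f + g); apply/funext => v; rewrite mevalD.
- by exists (f * g); apply/funext => v; rewrite mevalM.
Qed.

Lemma poly1fun_subalgebra : subalgebra poly1fun.
Proof.
split=> [c | _ _ [f ->] [g ->] | _ _ [f ->] [g ->]].
- by exists c%:P; apply/funext => v; rewrite hornerC.
- by exists (f + g); apply/funext => v; rewrite hornerD.
- by exists (f * g); apply/funext => v; rewrite hornerM.
Qed.

Lemma poly1fun_id : poly1fun id.
Proof. by exists 'X; apply/funext => t; rewrite hornerX. Qed.

Lemma polyfun_comp T (A : set (T -> F)) (V : vectType F) (h : T -> V) f :
  subalgebra A -> map_in A h -> polyfun f -> A (fun t => f (h t)).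
Proof. by move=> subA Ah [g ->]; exact: sub_meval. Qed.

Lemma map_in_id (V : vectType F) : map_in (@polyfun V) id.
Proof.
move=> i; exists ('X_i); apply/funext => v; by rewrite mevalXU.
Qed.

Lemma polyfun_zclosure (V : vectType F) (A : set V) f v :
  polyfun f -> zclosure A v -> (forall a, A a -> f a = 0) -> f v = 0.
Proof. by move=> [g ->] /[apply]. Qed.

Lemma zclosureP (V : vectType F) (A : set V) v :
  zclosure A v <-> forall f, polyfun f -> (forall a, A a -> f a = 0) -> f v = 0.
Proof.
split=> [Av f pf | Av g]; first exact: polyfun_zclosure.
by apply: (Av (fun v => g.@[coords v])); exists g.
Qed.

Lemma notin_zclosure (V : vectType F) (A : set V) v : ~ zclosure A v ->
  exists f, [/\ polyfun f, forall a, A a -> f a = 0 & f v <> 0].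
Proof.
move=> nA; apply: contrapT => nf; apply: nA; apply/zclosureP => f pf f0.
by apply: contrapT => fv; apply: nf; exists f.
Qed.

Lemma sub_zclosure (V : vectType F) (A : set V) : A `<=` zclosure A.
Proof. by move=> v Av f; apply. Qed.

Lemma zclosure_map (V W : vectType F) (h : V -> W) (A : set V) (B : set W) :
  map_in (@polyfun V) h -> (forall a, A a -> zclosure B (h a)) ->
  forall v, zclosure A v -> zclosure B (h v).
Proof.
move=> ph AB v Av; apply/zclosureP => f pf fB.
apply: (polyfun_zclosure (f := fun v => f (h v)) _ Av) => [|a Aa].
  exact: (polyfun_comp (polyfun_subalgebra V) ph pf).
exact: (polyfun_zclosure pf (AB _ Aa)).
Qed.

Lemma zclosure_linear (V W : vectType F) (h : V -> W) (A : set V) (B : set W) :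
  linear h -> (forall a, A a -> zclosure B (h a)) ->
  forall v, zclosure A v -> zclosure B (h v).
Proof.
move=> lh; apply: zclosure_map.
exact: (map_in_linear (polyfun_subalgebra V) lh (@map_in_id V)).
Qed.

Lemma zclosure_sub (V : vectType F) (A B : set V) :
  A `<=` zclosure B -> zclosure A `<=` zclosure B.
Proof. by move=> AB; apply: zclosure_map => //; exact: map_in_id. Qed.

End PolynomialFunctions.
Arguments polyfun {F} V.

(** * Formal derivatives, polynomial curves and tangent vectors *)

Section Derivatives.
Variable F : numFieldType.
Implicit Types (t c : F).

(** The derivative is the formal one of a polynomial representing [f], so no limit is taken. The
    value is unique because a polynomial over an infinite field is determined by its values. *)
Definition has_deriv (f : F -> F) t c : Prop :=
  exists2 p : {poly F}, f = horner p & p^`().[t] = c.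

Lemma has_deriv_poly1fun f t c : has_deriv f t c -> poly1fun f.
Proof. by move=> [p -> _]; exists p. Qed.

Lemma poly1fun_has_deriv (f : F -> F) t : poly1fun f -> exists c, has_deriv f t c.
Proof. by move=> [p ->]; exists p^`().[t], p. Qed.

Lemma has_deriv_cst t a : has_deriv (fun=> a) t 0.
Proof.
exists a%:P; first by apply/funext => s; rewrite hornerC.
by rewrite derivC horner0.
Qed.

Lemma has_deriv_id t : has_deriv id t 1.
Proof.
exists 'X; first by apply/funext => s; rewrite hornerX.
by rewrite derivX hornerC.
Qed.

Lemma has_deriv_add f g t c d : has_deriv f t c -> has_deriv g t d ->
  has_deriv (fun s => f s + g s) t (c + d).
Proof.
move=> [p -> <-] [q -> <-]; exists (p + q); last by rewrite derivD hornerD.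
by apply/funext => s; rewrite hornerD.
Qed.

Lemma has_deriv_mul f g t c d : has_deriv f t c -> has_deriv g t d ->
  has_deriv (fun s => f s * g s) t (c * g t + f t * d).
Proof.
move=> [p -> <-] [q -> <-]; exists (p * q); last by rewrite derivM hornerD !hornerM.
by apply/funext => s; rewrite hornerM.
Qed.

Lemma has_deriv_sum (I : Type) (r : seq I) (P : pred I) (f : I -> F -> F) t (c : I -> F) :
  (forall i, P i -> has_deriv (f i) t (c i)) ->
  has_deriv (fun s => \sum_(i <- r | P i) f i s) t (\sum_(i <- r | P i) c i).
Proof.
move=> df; elim: r => [|i r IH].
  rewrite big_nil (_ : (fun _ => _) = fun=> 0); first exact: has_deriv_cst.
  by apply/funext => s; rewrite big_nil.
rewrite big_cons; case Pi: (P i).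
  rewrite (_ : (fun _ => _) = fun s => f i s + \sum_(i <- r | P i) f i s).
    by apply: has_deriv_add => //; exact: df.
  by apply/funext => s; rewrite big_cons Pi.
by rewrite (_ : (fun _ => _) = fun s => \sum_(i <- r | P i) f i s) //;
  apply/funext => s; rewrite big_cons Pi.
Qed.

Lemma poly_eq0 (p : {poly F}) : (forall t, p.[t] = 0) -> p = 0.
Proof.
move=> p0; apply: (@roots_geq_poly_eq0 _ p [seq i%:R | i <- iota 0 (size p)]).
- by apply/allP => x _; apply/eqP.
- by rewrite map_inj_uniq ?iota_uniq // => i j /eqP; rewrite eqr_nat => /eqP.
- by rewrite size_map size_iota.
Qed.

(** The product of the two polynomials vanishes identically, and polynomials form a domain. In the
    applications [d] is a determinant or a rank detector, off whose zeros a curve stays in the set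
    under study. *)
Lemma poly1fun_eq0 (f d : F -> F) t :
  poly1fun f -> poly1fun d -> d t <> 0 -> (forall s, d s <> 0 -> f s = 0) ->
  f = fun=> 0.
Proof.
move=> [p ->] [q ->] qt pq; have /eqP : p * q = 0.
  apply: poly_eq0 => s; rewrite hornerM.
  by have [->|/eqP /pq ->] := eqVneq q.[s] 0; rewrite ?mulr0 ?mul0r.
rewrite mulf_eq0 => /orP[] /eqP p0; last by case: qt; rewrite p0 horner0.
by apply/funext => s; rewrite p0 horner0.
Qed.

Lemma poly1fun_neq0 (f g : F -> F) a b : poly1fun f -> poly1fun g -> f a <> 0 -> g b <> 0 ->
  exists s, f s <> 0 /\ g s <> 0.
Proof.
move=> pf pg fa gb; apply: contrapT => ns.
apply: fa; suff -> : f = fun=> 0 by [].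
apply: (poly1fun_eq0 pf pg gb) => s gs; apply: contrapT => fs; apply: ns.
by exists s.
Qed.

Lemma has_deriv_unique f t c d : has_deriv f t c -> has_deriv f t d -> c = d.
Proof.
move=> [p -> <-] [q pq <-]; suff -> : p = q by [].
apply/eqP; rewrite -subr_eq0; apply/eqP/poly_eq0 => s.
by rewrite hornerD hornerN -[p.[s]]/(horner p s) pq subrr.
Qed.

Lemma has_deriv_eq0 f (d : F -> F) t c : has_deriv f t c ->
  poly1fun d -> d t <> 0 -> (forall s, d s <> 0 -> f s = 0) -> c = 0.
Proof.
move=> df pd dt f0; apply: (has_deriv_unique df).
by rewrite (poly1fun_eq0 (has_deriv_poly1fun df) pd dt f0); exact: has_deriv_cst.
Qed.

Definition mx_deriv m n (M : F -> 'M[F]_(m, n)) t (D : 'M[F]_(m, n)) : Prop :=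
  forall i j, has_deriv (fun s => M s i j) t (D i j).

Lemma mx_deriv_cst m n t (M : 'M[F]_(m, n)) : mx_deriv (fun=> M) t 0.
Proof. by move=> i j; rewrite mxE; exact: has_deriv_cst. Qed.

Lemma mx_deriv_mul m n k t (M : F -> 'M[F]_(m, n)) (N : F -> 'M[F]_(n, k)) C D :
  mx_deriv M t C -> mx_deriv N t D ->
  mx_deriv (fun s => M s *m N s) t (C *m N t + M t *m D).
Proof.
move=> dM dN i j.
have := has_deriv_sum (index_enum 'I_n) (P := predT) (fun l _ =>
  has_deriv_mul (dM i l) (dN l j)).
rewrite big_split /= !mxE; congr has_deriv.
by apply/funext => s; rewrite mxE.
Qed.

Lemma mx_deriv_line m n t (M N : 'M[F]_(m, n)) :
  mx_deriv (fun s => M + s *: N) t N.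
Proof.
move=> i j; have := has_deriv_add (has_deriv_cst t (M i j))
  (has_deriv_mul (has_deriv_id t) (has_deriv_cst t (N i j))).
rewrite add0r mulr0 mul1r addr0.
by congr has_deriv; apply/funext => s; rewrite !mxE.
Qed.

Definition map_deriv (V : vectType F) (h : F -> V) t (w : V) : Prop :=
  forall i, has_deriv (fun s => coords (h s) i) t (coords w i).

Lemma map_deriv_in (V : vectType F) (h : F -> V) t w :
  map_deriv h t w -> map_in (@poly1fun F) h.
Proof. by move=> dh i; exact: has_deriv_poly1fun (dh i). Qed.

Lemma map_in_deriv (V : vectType F) (h : F -> V) t :
  map_in (@poly1fun F) h -> exists w, map_deriv h t w.
Proof.
move=> ph; have /choice [c cP] : forall i : 'I_(\dim {:V}),
    exists c, has_deriv (fun s => coords (h s) i) t c.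
  by move=> i; exact: poly1fun_has_deriv (ph i).
exists (\sum_i c i *: (vbasis {:V})`_i) => i.
rewrite {2}/coords coord_sum_free; first exact: cP.
exact: basis_free (vbasisP _).
Qed.

Lemma map_deriv_line (V : vectType F) t (v w : V) :
  map_deriv (fun s => v + s *: w) t w.
Proof.
move=> i; have := has_deriv_add (has_deriv_cst t (coords v i))
  (has_deriv_mul (has_deriv_id t) (has_deriv_cst t (coords w i))).
rewrite add0r mulr0 mul1r addr0.
by congr has_deriv; apply/funext => s; rewrite /coords linearD linearZ.
Qed.

Lemma map_deriv_linear (V W : vectType F) (h : F -> V) t w (u : V -> W) :
  linear u -> map_deriv h t w -> map_deriv (fun s => u (h s)) t (u w).
Proof.
move=> lu dh; pose ul := GRing.isLinear.Build _ _ _ _ _ lu.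
pose uL : {linear V -> W} := HB.pack u ul.
have E v i : coords (u v) i =
    \sum_j coords v j * coords (uL (vbasis {:V})`_j) i.
  rewrite {1}[v]coordsK -[u]/(uL : _ -> _) linear_sum /coords linear_sum.
  by apply: eq_bigr => j _; rewrite [uL _]linearZ linearZ.
move=> i; rewrite E; under [X in has_deriv X]eq_fun do rewrite E.
apply: has_deriv_sum => j _.
have := has_deriv_mul (dh j) (has_deriv_cst t (coords (uL (vbasis {:V})`_j) i)).
by rewrite mulr0 addr0.
Qed.

Lemma map_deriv_add (V : vectType F) (h k : F -> V) t v w :
  map_deriv h t v -> map_deriv k t w ->
  map_deriv (fun s => h s + k s) t (v + w).
Proof.
move=> dh dk i; have := has_deriv_add (dh i) (dk i).
by rewrite /coords linearD; congr has_deriv; apply/funext => s; rewrite linearD.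
Qed.

Lemma map_deriv_pair (V W : vectType F) (h : F -> V) (k : F -> W) t v w :
  map_deriv h t v -> map_deriv k t w ->
  map_deriv (fun s => (h s, k s)) t (v, w).
Proof.
move=> dh dk.
have l1 : linear (fun v : V => (v, 0 : W)).
  by move=> c a b; apply/pair_eqP; rewrite /= scaler0 addr0 !eqxx.
have l2 : linear (fun w : W => (0 : V, w)).
  by move=> c a b; apply/pair_eqP; rewrite /= scaler0 addr0 !eqxx.
have := map_deriv_add (map_deriv_linear l1 dh) (map_deriv_linear l2 dk).
rewrite (_ : (v, 0) + (0, w) = (v, w)); last first.
  by apply/pair_eqP; rewrite /= addr0 add0r !eqxx.
congr map_deriv; apply/funext => s.
by apply/pair_eqP; rewrite /= addr0 add0r !eqxx.
Qed.

Lemma map_deriv_mx m n (M : F -> 'M[F]_(m, n)) t D :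
  mx_deriv M t D -> map_deriv M t D.
Proof.
move=> dM i.
have E (X : 'M[F]_(m, n)) : coords X i =
   \sum_(k : 'I_m * 'I_n) X k.1 k.2 * coords (delta_mx k.1 k.2 : 'M_(m, n)) i.
  rewrite {1}[X]matrix_sum_delta pair_bigA /coords linear_sum.
  by apply: eq_bigr => k _; rewrite linearZ.
rewrite E; under [X in has_deriv X]eq_fun do rewrite E.
apply: has_deriv_sum => k _.
have := has_deriv_mul (dM k.1 k.2)
  (has_deriv_cst t (coords (delta_mx k.1 k.2 : 'M_(m, n)) i)).
by rewrite mulr0 addr0.
Qed.

Lemma mx_deriv_map m n (M : F -> 'M[F]_(m, n)) t D :
  map_deriv M t D -> mx_deriv M t D.
Proof.
move=> dM i j.
have E (X : 'M[F]_(m, n)) : X i j =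
   \sum_k coords X k * ((vbasis {:'M[F]_(m, n)})`_k : 'M_(m, n)) i j.
  by rewrite {1}[X]coordsK summxE; apply: eq_bigr => k _; rewrite mxE.
rewrite E; under [X in has_deriv X]eq_fun do rewrite E.
apply: has_deriv_sum => k _.
have := has_deriv_mul (dM k)
  (has_deriv_cst t (((vbasis {:'M[F]_(m, n)})`_k : 'M_(m, n)) i j)).
by rewrite mulr0 addr0.
Qed.

(** Chain rule: the polynomials satisfying it include the constants and the variables and are closed
    under sums and products, hence are all polynomials. *)
Lemma has_deriv_meval n (f : {mpoly F[n]}) (v : F -> 'I_n -> F) t (c : 'I_n -> F) :
  (forall i, has_deriv (v^~ i) t (c i)) ->
  has_deriv (fun s => f.@[v s]) t (\sum_i (f^`M(i)).@[v t] * c i).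
Proof.
move=> dv.
pose P f := has_deriv (fun s => f.@[v s]) t (\sum_i (f^`M(i)).@[v t] * c i).
have PC a : P a%:MP.
  rewrite /P big1 => [|i _]; last by rewrite mderivC meval0 mul0r.
  rewrite (_ : (fun _ => _) = fun=> a); first exact: has_deriv_cst.
  by apply/funext => s; rewrite mevalC.
have PX i : P 'X_i.
  rewrite /P (_ : (fun _ => _) = v^~ i); last by apply/funext => s; rewrite mevalXU.
  rewrite (bigD1 i) //= big1 => [|j ji].
    rewrite addr0 mderivX mevalZ mnm1E eqxx mul1r.
    rewrite (_ : (_ - _)%MM = 0%MM) ?mpolyX0 ?meval1 ?mul1r //.
    by apply/mnmP => j; rewrite mnmBE mnm1E mnm0E subnn.
  by rewrite mderivX mnm1E eq_sym (negPf ji) scale0r meval0 mul0r.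
have PM g h : P g -> P h -> P (g * h).
  move=> dg dh; have := has_deriv_mul dg dh; rewrite /P.
  have -> : \sum_i ((g * h)^`M(i)).@[v t] * c i =
     (\sum_i (g^`M(i)).@[v t] * c i) * h.@[v t] +
     g.@[v t] * (\sum_i (h^`M(i)).@[v t] * c i).
    rewrite mulr_suml mulr_sumr -big_split /=; apply: eq_bigr => i _.
    by rewrite mderivM mevalD !mevalM mulrDl mulrA; congr (_ + _); rewrite mulrAC.
  by congr has_deriv; apply/funext => s; rewrite mevalM.
have PD g h : P g -> P h -> P (g + h).
  move=> dg dh; have := has_deriv_add dg dh; rewrite /P.
  have -> : \sum_i ((g + h)^`M(i)).@[v t] * c i =
     (\sum_i (g^`M(i)).@[v t] * c i) + (\sum_i (h^`M(i)).@[v t] * c i).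
    rewrite -big_split /=; apply: eq_bigr => i _.
    by rewrite mderivD mevalD mulrDl.
  by congr has_deriv; apply/funext => s; rewrite mevalD.
rewrite -/(P f) [f]mpolyE; elim: (msupp f) => [|m r IH].
  by rewrite big_nil -[0]/(0%:MP).
rewrite big_cons; apply: (PD) => //.
rewrite -mul_mpolyC; apply: (PM) => //; rewrite mpolyXE_id.
elim: (index_enum _) => [|i s IHs]; first by rewrite big_nil -[1]/(1%:MP).
rewrite big_cons; apply: (PM) => //.
elim: (m i) => [|k IHk]; first by rewrite expr0 -[1]/(1%:MP).
by rewrite exprS; apply: (PM).
Qed.

Section Tangent.
Variable V : vectType F.
Implicit Types (A : set V) (a v w : V).

(** The curve may leave [A] at the zeros of [d]: a polynomial vanishing on [A] still vanishes
    identically along it. *)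
Lemma tangent_curve A (h : F -> V) (d : F -> F) t w :
  map_deriv h t w -> poly1fun d -> d t <> 0 -> (forall s, d s <> 0 -> A (h s)) ->
  tangent A (h t) w.
Proof.
move=> dh pd dt Ah f fA.
apply: (has_deriv_eq0 (has_deriv_meval f dh) pd dt) => s ds.
by apply: fA; exact: Ah.
Qed.

Lemma tangentP A a v (f : V -> F) c : tangent A a v -> polyfun V f ->
  (forall b, A b -> f b = 0) -> has_deriv (fun s => f (a + s *: v)) 0 c -> c = 0.
Proof.
move=> Tv [g ->] g0 df; apply: (has_deriv_unique df).
have := has_deriv_meval g (map_deriv_line 0 a v).
by rewrite scale0r addr0 (Tv g g0).
Qed.

Lemma tangent_sub A a v w : tangent A a v -> tangent A a w -> tangent A a (v - w).
Proof.
move=> Tv Tw f f0; have := Tv f f0; have := Tw f f0.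
move=> e1 e2; have := congr2 (fun x y => x - y) e2 e1.
rewrite /= subrr -sumrB; apply: etrans.
by apply: eq_bigr => i _; rewrite /coords linearB mulrBr.
Qed.

(** [g'] is the derivative of [g] along the vector field [X]. Its first property turns iterated
    derivation into Taylor coefficients along an integral curve; its second one keeps an ideal
    stable when [X] is tangent to the zero set. *)
Lemma directional_derivative (g : V -> F) (X : V -> V) :
  polyfun V g -> map_in (polyfun V) X ->
  exists2 g' : V -> F, polyfun V g' &
    (forall h t, map_deriv h t (X (h t)) -> has_deriv (fun s => g (h s)) t (g' (h t)))
    /\ (forall A a, tangent A a (X a) -> (forall b, A b -> g b = 0) -> g' a = 0).
Proof.
move=> [f ->] pX; exists (fun a => \sum_i (f^`M(i)).@[coords a] * coords (X a) i).
  apply: sub_sum (polyfun_subalgebra V) _ _ _ _ _ => i _.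
  by apply: sub_mul (polyfun_subalgebra V) _ _ _ _ => //; exists (f^`M(i)).
split=> [h t dh | A a Ta fA]; last exact: Ta.
exact: has_deriv_meval dh.
Qed.

End Tangent.

Lemma tangent_linear (V W : vectType F) (u : V -> W) (A : set V) (B : set W) a v :
  linear u -> (forall b, A b -> B (u b)) -> tangent A a v ->
  tangent B (u a) (u v).
Proof.
move=> lu AB Tv f fB.
have pu := map_in_linear (polyfun_subalgebra V) lu (@map_in_id F V).
have pf : polyfun W (fun w => f.@[coords w]) by exists f.
have pfu := polyfun_comp (polyfun_subalgebra V) pu pf.
apply: (tangentP Tv pfu) => [b Ab|]; first exact: fB (AB _ Ab).
have := has_deriv_meval f (map_deriv_linear lu (map_deriv_line 0 a v)).
by rewrite scale0r addr0.
Qed.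

(* Characteristic zero: all the Taylor coefficients of [f] at 0 vanish. *)
Lemma poly1fun_vanish_derivs (I : set (F -> F)) :
  (forall f, I f -> [/\ poly1fun f, f 0 = 0 &
     exists2 g, I g & forall s, has_deriv f s (g s)]) ->
  forall f, I f -> f = fun=> 0.
Proof.
move=> HI.
suff H n : forall p : {poly F}, (size p <= n)%N -> I (horner p) -> p = 0.
  move=> f If; have [[p E] _ _] := HI f If; move: If; rewrite E => Ip.
  by apply/funext => s; rewrite (H _ p (leqnn _) Ip) horner0.
elim: n => [|n IH] p; first by rewrite leqn0 size_poly_eq0 => /eqP.
move=> sp Ip; have [_ p0 [g Ig dg]] := HI _ Ip.
have Eg : g = horner p^`().
  apply/funext => s; apply: has_deriv_unique (dg s) _; by exists p.
have [->//|p_neq0] := eqVneq p 0.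
have p'0 : p^`() = 0.
  apply: IH; last by rewrite -Eg.
  by rewrite -ltnS; apply: leq_trans sp; exact: lt_size_deriv.
have sp1 : (size p <= 1)%N.
  rewrite leqNgt; apply/negP => s1.
  have /eqP : p^`()`_((size p).-2) = 0 by rewrite p'0 coef0.
  rewrite coef_deriv prednK; last by case: (size p) s1 => [|[]].
  rewrite -mulr_natr mulf_eq0 pnatr_eq0 -[p`__]/(lead_coef p) lead_coef_eq0.
  by rewrite (negPf p_neq0) /=; case: (size p) s1 => [|[]].
by move: p0; rewrite [p](size1_polyC sp1) hornerC => ->.
Qed.

End Derivatives.

(** * Schubert cells of matrices *)

Section Triangular.
Variable F : fieldType.

Definition upper n (b : 'M[F]_n) : Prop := forall i j : 'I_n, (j < i)%N -> b i j = 0.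
Definition supper n (a : 'M[F]_n) : Prop := forall i j : 'I_n, (j <= i)%N -> a i j = 0.

Lemma upper1 n : upper (1%:M : 'M_n).
Proof. by move=> i j ji; rewrite mxE; case: eqP ji => // ->; rewrite ltnn. Qed.

Lemma upper_add n (b c : 'M_n) : upper b -> upper c -> upper (b + c).
Proof. by move=> ub uc i j ji; rewrite mxE ub // uc // addr0. Qed.

Lemma upper_scale n t (b : 'M_n) : upper b -> upper (t *: b).
Proof. by move=> ub i j ji; rewrite mxE ub // mulr0. Qed.

Lemma upper_mul n (b c : 'M_n) : upper b -> upper c -> upper (b *m c).
Proof.
move=> ub uc i j ji; rewrite mxE big1 // => k _.
have [ki|ik] := ltnP k i; first by rewrite ub ?mul0r.
by rewrite uc ?mulr0 // (leq_trans ji).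
Qed.

Lemma supper_add n (b c : 'M_n) : supper b -> supper c -> supper (b + c).
Proof. by move=> ub uc i j ji; rewrite mxE ub // uc // addr0. Qed.

Lemma supper_scale n t (b : 'M_n) : supper b -> supper (t *: b).
Proof. by move=> ub i j ji; rewrite mxE ub // mulr0. Qed.

Lemma supper_mull n (b a : 'M_n) : upper b -> supper a -> supper (b *m a).
Proof.
move=> ub sa i j ji; rewrite mxE big1 // => k _.
have [ki|ik] := ltnP k i; first by rewrite ub ?mul0r.
by rewrite sa ?mulr0 // (leq_trans ji).
Qed.

Lemma supper_mulr n (a b : 'M_n) : supper a -> upper b -> supper (a *m b).
Proof.
move=> sa ub i j ji; rewrite mxE big1 // => k _.
have [ki|ik] := leqP k i; first by rewrite sa ?mul0r.
by rewrite ub ?mulr0 // (leq_ltn_trans ji).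
Qed.

Lemma upper_det n (b : 'M_n) : upper b -> \det b = \prod_i b i i.
Proof.
move=> ub; rewrite -det_tr det_trig; first by apply: eq_bigr => i _; rewrite mxE.
by apply/is_trig_mxP => i j ij; rewrite mxE ub.
Qed.

Lemma upper_unit n (b : 'M_n) : upper b -> (b \in unitmx) = [forall i, b i i != 0].
Proof.
move=> ub; rewrite unitmxE upper_det // unitfE.
by apply/prodf_neq0/forallP => [H i | H i _]; exact: H.
Qed.

Lemma upper_inv n (b : 'M_n) : upper b -> upper (invmx b).
Proof.
move=> ub; have [bu|] := boolP (b \in unitmx); last by rewrite /invmx => /negPf ->.
move=> i0 j ji; apply/eqP; apply: contraT => c0.
(* Take the lowest nonzero entry of column [j] of the inverse below the diagonal: in its row [i],
   the product with [b] reduces to the diagonal term, which must then be 0. *)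
case: (@arg_maxnP _ i0 (fun i : 'I_n => (j < i)%N && (invmx b i j != 0)) (@nat_of_ord n)).
  by rewrite ji c0.
move=> i /andP[{}ji ci0] imax.
have : (b *m invmx b) i j = b i i * invmx b i j.
  rewrite mxE (bigD1 i) //= big1 ?addr0 // => k ki.
  have [lt_ki|le_ik] := ltnP k i; first by rewrite ub ?mul0r.
  apply/eqP; rewrite mulf_eq0; apply/orP; right; apply: contraT => ck.
  have := imax k; rewrite ck (leq_trans ji) //= => /(_ isT) ge_ki.
  by case/eqP: ki; apply/val_inj/anti_leq; rewrite ge_ki.
rewrite mulmxV // mxE -val_eqE /= gtn_eqF // => /esym/eqP.
rewrite mulf_eq0 (negPf ci0) orbF => bii.
by move: bu; rewrite upper_unit // => /forallP /(_ i); rewrite bii.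
Qed.

Lemma supper_conj n (b a : 'M_n) : upper b -> supper a ->
  supper (b *m a *m invmx b).
Proof. by move=> ub sa; apply: supper_mulr (upper_inv ub); exact: supper_mull. Qed.

Lemma supper_nilpotent n (a : 'M_n) : supper a -> exists k, a ^+ k = 0.
Proof.
move=> sa; exists n.
suff H k (i j : 'I_n) : (j < i + k)%N -> (a ^+ k) i j = 0.
  by apply/matrixP => i j; rewrite [RHS]mxE H // ltn_addl.
elim: k i j => [|k IH] i j.
  by rewrite addn0 expr0 => ji; rewrite mxE; case: eqP ji => // ->; rewrite ltnn.
rewrite addnS ltnS => jik; rewrite exprSr mxE big1 // => l _.
have [lt_l|le_l] := ltnP l (i + k); first by rewrite IH ?mul0r.
by rewrite sa ?mulr0 // (leq_trans jik).
Qed.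

End Triangular.

(** * Ranks and south-west corners of matrices *)

Section Rank.
Variable F : fieldType.

(** With [rank_ge_det] this makes a lower bound on the rank an open condition: [\det (A *m x' *m C)]
    is polynomial in [x'] and nonzero at [x]. The matrices [A] and [C] play the part of the rows and
    columns of a maximal minor. *)
Lemma rank_witness m n (x : 'M[F]_(m, n)) : exists (A : 'M_(\rank x, m)) (C : 'M_(n, \rank x)),
  A *m x *m C = 1%:M.
Proof.
have /row_fullP [A HA] := col_base_full x.
have /row_freeP [C HC] := row_base_free x.
exists A, C; transitivity (A *m (col_base x *m row_base x) *m C).
  by rewrite mulmx_base.
by rewrite mulmxA HA mul1mx.
Qed.

Lemma rank_ge_det m n r (A : 'M[F]_(r, m)) (x : 'M_(m, n)) (C : 'M_(n, r)) :
  \det (A *m x *m C) <> 0 -> (r <= \rank x)%N.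
Proof.
move=> d0; have : A *m x *m C \in unitmx by rewrite unitmxE unitfE; apply/eqP.
move/mxrank_unit => <-; exact: leq_trans (mxrankM_maxl _ _) (mxrankM_maxr _ _).
Qed.

(** The south-west corner, padded with zeros to keep its size. Its rank is the dimension of x E_i +
    F_j modulo F_j for the standard flags. *)
Definition corner m n (i j : nat) (x : 'M[F]_(m, n)) : 'M[F]_(m, n) :=
  copid_mx j *m x *m pid_mx i.

Lemma cornerE m n i j (x : 'M[F]_(m, n)) k l :
  corner i j x k l = (x k l) *+ ((j <= k)%N && (l < i)%N).
Proof.
rewrite /corner mxE (bigD1 l) //= [X in _ + X]big1 => [|l' l'l]; last first.
  by rewrite [pid_mx i l' l]mxE; move: l'l; rewrite -val_eqE => /negPf /= ->; rewrite mulr0.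
rewrite addr0 [pid_mx i l l]mxE eqxx /= mulmxBl mul1mx mxE [X in (_ + X) * _]mxE.
rewrite mxE (bigD1 k) //= big1 => [|k' k'k]; last first.
  rewrite mxE; move: k'k; rewrite -val_eqE eq_sym => /negPf -> /=.
  by rewrite mul0r.
rewrite mxE eqxx addr0 /= [(k < j)%N]ltnNge.
by case: (j <= k)%N; case: (l < i)%N;
  rewrite /= ?mulr1 ?mulr0 ?mulr0n ?mulr1n ?mul1r ?mul0r ?subrr ?subr0.
Qed.

Lemma copid_mulE m n j (x : 'M[F]_(m, n)) k l :
  (copid_mx j *m x) k l = x k l *+ (j <= k)%N.
Proof.
by have := cornerE n j x k l; rewrite ltn_ord andbT /corner pid_mx_1 mulmx1.
Qed.

Lemma copid_upper m j (b : 'M[F]_m) : upper b ->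
  copid_mx j *m b *m copid_mx j = copid_mx j *m b.
Proof.
move=> ub; apply/matrixP => k l.
rewrite [X in _ *m X](_ : copid_mx j = 1%:M - pid_mx j) // mulmxBr mulmx1 [LHS]mxE.
rewrite [X in _ + X]mxE -[_ *m b *m pid_mx j]/(corner j j b) cornerE copid_mulE.
have [jk|] := leqP j k; last by rewrite mulr0n oppr0 addr0.
have [lj|] := ltnP l j; last by rewrite mulr0n oppr0 addr0.
by rewrite ub ?mul0rn ?subr0 // (leq_trans lj).
Qed.

Lemma pid_upper n i (c : 'M[F]_n) : upper c ->
  pid_mx i *m c *m (pid_mx i : 'M_n) = c *m (pid_mx i : 'M_n).
Proof.
move=> uc; apply/matrixP => k l.
have := cornerE i i c k l; rewrite /corner mulmxBl mul1mx mulmxBl mxE [X in _ + X]mxE.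
have -> : (c k l) *+ ((i <= k)%N && (l < i)%N) = 0.
  have [ik|] := leqP i k; last by [].
  have [li|] := ltnP l i; last by [].
  by rewrite uc // (leq_trans li).
by move/eqP; rewrite subr_eq0 => /eqP.
Qed.

(** Upper triangular matrices preserve the standard flags, so the truncations can be repeated next
    to [x], and the corner of the product factors through the corner of [x]. *)
Lemma rank_corner_upper m n i j b (x : 'M[F]_(m, n)) c : upper b -> upper c ->
  (\rank (corner i j (b *m x *m c)) <= \rank (corner i j x))%N.
Proof.
move=> ub uc; suff -> : corner i j (b *m x *m c) =
   (copid_mx j *m b) *m corner i j x *m (c *m pid_mx i).
  exact: leq_trans (mxrankM_maxl _ _) (mxrankM_maxr _ _).
transitivity ((copid_mx j *m b *m copid_mx j) *m x *m (pid_mx i *m c *m (pid_mx i : 'M_n))).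
  by rewrite copid_upper // pid_upper // /corner !mulmxA.
by rewrite /corner !mulmxA.
Qed.

End Rank.

(** * Ranks of partial permutation matrices *)

Section PartialPermutations.
Variables (p q : nat).
Implicit Types tau : 'M[bool]_(p, q).

Definition ones (i j : nat) tau : nat :=
  (\sum_(l < q | l < i) \sum_(k < p | j <= k) tau k l)%N.

Lemma sum_bool_le1 (I : finType) (P : pred I) :
  (\sum_i P i <= 1)%N <-> (forall a b, P a -> P b -> a = b).
Proof.
have -> : (\sum_i P i)%N = #|P|.
  by rewrite -sum1_card [RHS]big_mkcond /=; apply: eq_bigr => i _; rewrite -topredE /=; case: (P i).
split=> [/card_le1_eqP H a b Pa Pb | H]; first exact: H.
by apply/card_le1_eqP => a b Pa Pb; exact: H.
Qed.

Lemma partial_permP tau : partial_perm tau <->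
  (forall k l l', tau k l -> tau k l' -> l = l') /\
  (forall l k k', tau k l -> tau k' l -> k = k').
Proof.
split=> [[H1 H2] | [H1 H2]]; split=> a.
- by move: (H1 a) => /sum_bool_le1.
- by move: (H2 a) => /(sum_bool_le1 (fun k => tau k a)).
- by apply/sum_bool_le1; exact: H1.
- by apply/(sum_bool_le1 (fun k => tau k a)); exact: H2.
Qed.

Definition restr (i j : nat) tau : 'M[bool]_(p, q) :=
  \matrix_(k, l) (tau k l && (j <= k)%N && (l < i)%N).

Lemma restr_partial_perm i j tau : partial_perm tau -> partial_perm (restr i j tau).
Proof.
move=> /partial_permP [H1 H2]; apply/partial_permP; split=> a b c;
  rewrite !mxE => /andP[/andP[t1 _] _] /andP[/andP[t2 _] _];
  [exact: H1 t1 t2 | exact: H2 t1 t2].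
Qed.

Lemma ones_restr i j tau : ones i j tau = #|[pred kl | restr i j tau kl.1 kl.2]|.
Proof.
rewrite /ones -sum1_card [RHS]big_mkcond /= big_mkcond /=.
transitivity (\sum_(l < q) \sum_(k < p) restr i j tau k l)%N.
  apply: eq_bigr => l _; have [li|li] := ltnP l i; last first.
    by rewrite big1 // => k _; rewrite mxE ltnNge li andbF.
  rewrite big_mkcond; apply: eq_bigr => k _; rewrite mxE li andbT.
  by case: (j <= k)%N; rewrite ?andbT ?andbF.
rewrite exchange_big pair_bigA; apply: eq_bigr => -[k l] _ /=.
by rewrite -topredE /=; case: (restr _ _ _ _ _).
Qed.

Variable F : fieldType.

Definition pmx tau : 'M[F]_(p, q) := \matrix_(k, l) (tau k l)%:R.

Lemma corner_pmx i j tau : corner i j (pmx tau) = pmx (restr i j tau).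
Proof.
apply/matrixP => k l; rewrite cornerE !mxE -andbA.
by case: (tau k l); case: (_ && _) => //=; rewrite mul0rn.
Qed.

Section Witness.
Variable tau : 'M[bool]_(p, q).
Hypothesis tauP : partial_perm tau.

Definition one_pos := {kl : 'I_p * 'I_q | tau kl.1 kl.2}.

(** Selects the rows containing a 1, in the order in which [one_cols] selects the columns; this
    common order makes the selected submatrix of [pmx tau] the identity. *)
Definition one_rows : 'M[F]_(#|{: one_pos}|, p) :=
  \matrix_(s, k) (k == (val (enum_val s)).1)%:R.
Definition one_cols : 'M[F]_(q, #|{: one_pos}|) :=
  \matrix_(l, s) (l == (val (enum_val s)).2)%:R.

Lemma mul_one_rows n (x : 'M[F]_(p, n)) s l :
  (one_rows *m x) s l = x (val (enum_val s)).1 l.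
Proof.
rewrite mxE (bigD1 (val (enum_val s)).1) //= mxE eqxx mul1r big1 ?addr0 // => k /negPf kE.
by rewrite mxE kE mul0r.
Qed.

Lemma mul_one_cols n (x : 'M[F]_(n, q)) s k :
  (x *m one_cols) k s = x k (val (enum_val s)).2.
Proof.
rewrite mxE (bigD1 (val (enum_val s)).2) //= mxE eqxx mulr1 big1 ?addr0 // => l /negPf lE.
by rewrite mxE lE mulr0.
Qed.

Lemma one_rows_pmx_cols : one_rows *m pmx tau *m one_cols = 1%:M.
Proof.
apply/matrixP => s s'; rewrite mul_one_cols mul_one_rows !mxE; congr (nat_of_bool _)%:R.
apply/idP/eqP => [t1 | ->]; last exact: (valP (enum_val s')).
have [H1 H2] := (partial_permP tau).1 tauP.
apply/enum_val_inj/val_inj; move: t1.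
case: (enum_val s) => -[k l] /= t3; case: (enum_val s') => -[k' l'] /= t2 t1.
by rewrite (H1 _ _ _ t1 t3) (H2 _ _ _ t2 t1).
Qed.

Lemma rank_pmx : \rank (pmx tau) = #|{: one_pos}|.
Proof.
apply/eqP; rewrite eqn_leq; apply/andP; split; last first.
  have := one_rows_pmx_cols => /(congr1 mxrank); rewrite mxrank1 => <-.
  exact: leq_trans (mxrankM_maxl _ _) (mxrankM_maxr _ _).
have [H1 H2] := (partial_permP tau).1 tauP.
(* Rows of [pmx tau] without a 1 are zero, so selecting the other rows and putting them back loses
   nothing; the number of selected rows bounds the rank. *)
suff -> : pmx tau = one_rows^T *m (one_rows *m pmx tau).
  exact: leq_trans (mxrankM_maxl _ _) (rank_leq_col _).
apply/matrixP => k l; rewrite mxE [RHS]mxE.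
under eq_bigr => s _ do rewrite mul_one_rows !mxE.
have [t|nt] := boolP (tau k l).
  pose s := enum_rank (exist (fun kl : 'I_p * 'I_q => tau kl.1 kl.2) (k, l) t : one_pos).
  rewrite (bigD1 s) //= enum_rankK /= eqxx t mulr1 big1 ?addr0 // => s' s's.
  case: eqP => [kE|]; last by rewrite mul0r.
  rewrite mul1r; case t': (tau _ l) => //; case/eqP: s's.
  rewrite -[s']enum_valK; congr enum_rank; apply/val_inj => /=.
  case: (enum_val s') kE t' => -[k' l'] /= t2 -> t1.
  by rewrite (H1 _ _ _ t1 t2).
rewrite big1 // => s _; case: eqP => [<-|]; last by rewrite mul0r.
by rewrite (negPf nt) mulr0.
Qed.

End Witness.

Lemma rank_corner_pmx i j tau : partial_perm tau -> \rank (corner i j (pmx tau)) = ones i j tau.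
Proof.
by move=> tauP; rewrite corner_pmx rank_pmx ?ones_restr ?card_sig //; exact: restr_partial_perm.
Qed.

End PartialPermutations.

(** * Bruhat decomposition: the cells are orbits of pairs of triangular matrices *)

Section Bruhat.
Variables (F : fieldType) (p q : nat).
Implicit Types (tau : 'M[bool]_(p, q)) (x : 'M[F]_(p, q)).

Definition upper_unitmx n (b : 'M[F]_n) : Prop := upper b /\ b \in unitmx.

Lemma upper_unitmx_mul n (b c : 'M[F]_n) :
  upper_unitmx b -> upper_unitmx c -> upper_unitmx (b *m c).
Proof. by move=> [ub bu] [uc cu]; split; [exact: upper_mul | rewrite unitmx_mul bu]. Qed.

Lemma upper_unitmx_inv n (b : 'M[F]_n) : upper_unitmx b -> upper_unitmx (invmx b).
Proof. by move=> [ub bu]; split; [exact: upper_inv | rewrite unitmx_inv]. Qed.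

Lemma upper_unitmx1 n : upper_unitmx (1%:M : 'M[F]_n).
Proof. by split; [exact: upper1 | exact: unitmx1]. Qed.

(** The cell over the standard flags: the dimension [j] of F_j is subtracted from both sides of the
    condition in [schubert]. *)
Definition schub tau : set 'M[F]_(p, q) :=
  [set x | forall i j, (i <= q)%N -> (j <= p)%N ->
     \rank (corner i j x) = ones i j tau].

Lemma pmx_schub tau : partial_perm tau -> schub tau (pmx F tau).
Proof. by move=> tauP i j _ _; rewrite rank_corner_pmx. Qed.

Lemma schub_upper tau b x c : upper_unitmx b -> upper_unitmx c ->
  schub tau x -> schub tau (b *m x *m c).
Proof.
move=> [ub bu] [uc cu] Sx i j iq jp; rewrite -Sx //; apply/eqP.
rewrite eqn_leq rank_corner_upper //=.
have := rank_corner_upper i j (b *m x *m c) (upper_inv ub) (upper_inv uc).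
by rewrite !mulmxA mulVmx // mul1mx -mulmxA mulmxV // mulmx1.
Qed.

(** Each entry of [tau] is a second difference of the corner counts. *)
Lemma ones_inj tau tau' :
  (forall i j, (i <= q)%N -> (j <= p)%N -> ones i j tau = ones i j tau') -> tau = tau'.
Proof.
have onesS t (l : 'I_q) j :
    (ones l.+1 j t = ones l j t + \sum_(k < p | j <= k) t k l)%N.
  rewrite /ones (bigD1 l) //= addnC; congr (_ + _)%N.
  by apply: eq_bigl => l'; rewrite ltnS -val_eqE /= [RHS]ltn_neqAle andbC.
have colS (t : 'M[bool]_(p, q)) (l : 'I_q) (k : 'I_p) :
    (\sum_(k' < p | k <= k') t k' l = t k l + \sum_(k' < p | k.+1 <= k') t k' l)%N.
  rewrite (bigD1 k) //=; congr (_ + _)%N.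
  by apply: eq_bigl => k'; rewrite [RHS]ltn_neqAle andbC eq_sym -val_eqE.
move=> H; apply/matrixP => k l.
have c j : (j <= p)%N -> (\sum_(k' < p | j <= k') tau k' l = \sum_(k' < p | j <= k') tau' k' l)%N.
  move=> jp; have := H l.+1 j (ltn_ord l) jp; rewrite !onesS H ?(ltnW (ltn_ord l)) //.
  by move/addnI.
have := c k (ltnW (ltn_ord k)); rewrite !colS (c k.+1 (ltn_ord k)) => /addIn.
by case: (tau k l); case: (tau' k l).
Qed.

(** Gaussian elimination with restricted moves: lower rows may be added to upper ones and left
    columns to right ones. The columns are treated from left to right, each with its lowest
    available pivot. *)
Lemma bruhat x : exists (b : 'M[F]_p) (c : 'M[F]_q) tau,
  [/\ upper_unitmx b, upper_unitmx c, partial_perm tau & b *m x *m c = pmx F tau].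
Proof.
suff H m : (m <= q)%N -> exists (b : 'M[F]_p) (c : 'M[F]_q) tau,
    [/\ upper_unitmx b, upper_unitmx c, partial_perm tau,
        forall k l, tau k l -> (l < m)%N &
        forall k (l : 'I_q), (l < m)%N -> (b *m x *m c) k l = (tau k l)%:R].
  have [b [c [tau [ub uc tauP _ E]]]] := H q (leqnn q).
  by exists b, c, tau; split=> //; apply/matrixP => k l; rewrite E // mxE.
elim: m => [_ | m IH lt_mq].
  exists 1%:M, 1%:M, (const_mx false); split=> //; try exact: upper_unitmx1.
  - by apply/partial_permP; split=> a b c; rewrite !mxE.
  - by move=> k l; rewrite mxE.
have [b [c [tau [ub uc tauP tau_m E]]]] := IH (ltnW lt_mq).
have [H1 H2] := (partial_permP tau).1 tauP.
pose l0 := Ordinal lt_mq; pose y := b *m x *m c.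
(* The coefficient of an earlier column [l] is the entry of column [l0] in the row where column [l]
   has its 1. Subtracting this combination clears column [l0] in all rows already containing a 1. *)
pose w : 'cV[F]_q := \col_l (\sum_k (tau k l)%:R * y k l0).
pose c1 : 'M[F]_q := 1%:M - w *m delta_mx 0 l0.
have c1E l l' : c1 l l' = (l == l')%:R - w l 0 *+ (l' == l0).
  by rewrite !mxE big_ord1 !mxE eqxx /= mulr_natr.
have w0 (l : 'I_q) : (m <= l)%N -> w l 0 = 0.
  move=> ml; rewrite mxE big1 // => k _; case t: (tau k l); last by rewrite mul0r.
  by move: (tau_m _ _ t); rewrite ltnNge ml.
have uc1 : upper_unitmx c1.
  have u1 : upper c1.
    move=> l l' l'l; rewrite c1E -val_eqE /= gtn_eqF // sub0r.
    by case: eqP l'l => [-> /ltnW /w0 ->|_ _]; rewrite ?mul0rn ?mulr0n oppr0.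
  split=> //; rewrite upper_unit //; apply/forallP => l; rewrite c1E eqxx.
  by case: (l =P l0) => [->|_]; rewrite ?(w0 l0 (leqnn m)) ?mulr0n ?mul0rn subr0 oner_neq0.
pose y1 := y *m c1.
have y1E k l : y1 k l = y k l - (\sum_l' y k l' * w l' 0) *+ (l == l0).
  rewrite /y1 mulmxBr mulmx1 mulmxA [LHS]mxE; congr (_ + _).
  by rewrite mxE; congr (- _); rewrite mxE big_ord1 !mxE /= mulr_natr.
have y1m k (l : 'I_q) : (l < m)%N -> y1 k l = (tau k l)%:R.
  by move=> lm; rewrite y1E -val_eqE /= ltn_eqF // mulr0n subr0 E.
have y10 k : y1 k l0 = y k l0 *+ [forall l, ~~ tau k l].
  rewrite y1E eqxx mulr1n.
  have -> : \sum_l' y k l' * w l' 0 = \sum_l' (tau k l')%:R * w l' 0.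
    apply: eq_bigr => l' _; have [lt|ge] := ltnP l' m; first by rewrite /y E.
    by rewrite w0 // !mulr0.
  have [/forallP all0|/forallPn [l /negPn t]] := boolP [forall l, ~~ tau k l].
    by rewrite big1 ?subr0 // => l _; rewrite (negPf (all0 l)) mul0r.
  rewrite mulr0n (bigD1 l) //= t mul1r big1 => [|l' /eqP l'l]; last first.
    by case t': (tau k l'); rewrite ?mul0r //; case: l'l; exact: H1 t' t.
  rewrite addr0 [w l 0]mxE (bigD1 k) //= t mul1r big1 ?addr0 ?subrr // => k' /eqP k'k.
  by case t': (tau k' l); rewrite ?mul0r //; case: k'k; exact: H2 t' t.
have yc1 : b *m x *m (c *m c1) = y1 by rewrite mulmxA.
have [/existsP [k1 k1n] | /existsPn y10n] := boolP [exists k, y1 k l0 != 0]; last first.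
  exists b, (c *m c1), tau; split=> //.
  - exact: upper_unitmx_mul.
  - by move=> k l /tau_m lm; exact: ltnW.
  - move=> k l; rewrite yc1 ltnS leq_eqVlt => /orP[/eqP lm | /y1m -> //].
    have -> : l = l0 by apply: val_inj.
    move: (y10n k); rewrite negbK => /eqP ->.
    by case t: (tau _ _) => //; move: (tau_m _ _ t); rewrite ltnn.
(* The pivot is the lowest nonzero entry, since only the rows above it can be cleared. *)
case: (@arg_maxnP _ k1 (fun k => y1 k l0 != 0) (@nat_of_ord p) k1n) => k0 k0n kmax.
have free_k0 l : ~~ tau k0 l.
  by move: k0n; rewrite y10; case: forallP => [/(_ l) //|]; rewrite mulr0n eqxx.
(* Adding [u k 0] times row [k0] to row [k] turns column [l0] into the unit vector at [k0], the
   pivot being normalized as well. Row [k0] is zero in the earlier columns, which therefore do not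
   change. *)
pose u : 'cV[F]_p := \col_k (((k == k0)%:R - y1 k l0) / y1 k0 l0).
pose b1 : 'M[F]_p := 1%:M + u *m delta_mx 0 k0.
have b1E k k' : b1 k k' = (k == k')%:R + u k 0 *+ (k' == k0).
  by rewrite !mxE big_ord1 !mxE eqxx /= mulr_natr.
have ub1 : upper_unitmx b1.
  have u1 : upper b1.
    move=> k k' k'k; rewrite b1E -val_eqE /= gtn_eqF // add0r.
    case: eqP k'k => [-> k0k | _ _]; last by rewrite mulr0n.
    rewrite mxE -val_eqE /= gtn_eqF // sub0r mulr1n.
    suff -> : y1 k l0 = 0 by rewrite oppr0 mul0r.
    by apply/eqP; apply: contraTT k0k => /kmax; rewrite -leqNgt.
  split=> //; rewrite upper_unit //; apply/forallP => k; rewrite b1E eqxx.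
  case: (k =P k0) => [->|_]; last by rewrite mulr0n addr0 oner_neq0.
  by rewrite mxE eqxx mulr1n mulrBl mul1r divff // addrCA subrr addr0 invr_neq0.
pose tau1 : 'M[bool]_(p, q) := \matrix_(k, l) (tau k l || (k == k0) && (l == l0)).
have tau1P : partial_perm tau1.
  apply/partial_permP; split=> [k l l' | l k k']; rewrite !mxE.
    move=> /orP[t|/andP[/eqP -> /eqP ->]] /orP[t'|/andP[/eqP k'E /eqP l'E]].
    - exact: H1 t t'.
    - by move: t; rewrite k'E (negPf (free_k0 _)).
    - by move: t'; rewrite (negPf (free_k0 _)).
    - by rewrite l'E.
  move=> /orP[t|/andP[/eqP -> /eqP lE]] /orP[t'|/andP[/eqP k'E /eqP l'E]].
  - exact: H2 t t'.
  - by move: (tau_m _ _ t); rewrite l'E ltnn.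
  - by move: (tau_m _ _ t'); rewrite lE ltnn.
  - by rewrite k'E.
exists (b1 *m b), (c *m c1), tau1; split=> //; try exact: upper_unitmx_mul.
  move=> k l; rewrite mxE => /orP[/tau_m/ltnW //|/andP[_ /eqP ->]].
  exact: ltnSn.
move=> k l lm; rewrite -!mulmxA.
have -> : b1 *m (b *m (x *m (c *m c1))) = b1 *m y1 by rewrite /y1 /y !mulmxA.
have -> : (b1 *m y1) k l = y1 k l + u k 0 * y1 k0 l.
  rewrite mulmxDl mul1mx -mulmxA [LHS]mxE; congr (_ + _).
  rewrite mxE big_ord1; congr (_ * _).
  rewrite mxE (bigD1 k0) //= mxE !eqxx mul1r big1 ?addr0 // => k' /negPf k'k.
  by rewrite mxE k'k andbF mul0r.
move: lm; rewrite ltnS leq_eqVlt => /orP[/eqP lm | lm].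
  have -> : l = l0 by apply: val_inj.
  rewrite [u k 0]mxE mulfVK // addrC subrK mxE eqxx andbT.
  by case t: (tau _ _) => //; move: (tau_m _ _ t); rewrite ltnn.
rewrite !y1m // (negPf (free_k0 _)) mulr0 addr0 mxE.
by rewrite -[l == l0]val_eqE /= ltn_eqF // andbF orbF.
Qed.

(** Elimination puts [x] in the orbit of some partial permutation; corner ranks are invariant under
    the moves and determine it. *)
Lemma schub_orbit tau x : partial_perm tau -> schub tau x ->
  exists (b : 'M[F]_p) (c : 'M[F]_q),
    [/\ upper_unitmx b, upper_unitmx c & x = b *m pmx F tau *m c].
Proof.
move=> tauP Sx; have [b [c [tau' [ub uc tau'P E]]]] := bruhat x.
have Sx' := schub_upper ub uc Sx; rewrite E in Sx'.
have -> : tau = tau'.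
  apply: ones_inj => i j iq jp; rewrite -Sx' //; exact: rank_corner_pmx.
exists (invmx b), (invmx c); split; try exact: upper_unitmx_inv.
case: ub uc => [_ bu] [_ cu].
by rewrite -E !mulmxA mulVmx // mul1mx -mulmxA mulmxV // mulmx1.
Qed.

End Bruhat.

(** * Conormal bundles of the cells *)

Section ConormalFibre.
Variables (F : numFieldType) (p q : nat).
Implicit Types (tau : 'M[bool]_(p, q)) (x m : 'M[F]_(p, q)) (y : 'M[F]_(q, p)).

Definition Z0 tau : set ('M[F]_(p, q) * 'M[F]_(q, p)) :=
  [set z | [/\ schub tau z.1, supper (z.1 *m z.2) & supper (z.2 *m z.1)]].

Lemma Z0_conj tau b c x y : upper_unitmx b -> upper_unitmx c -> Z0 tau (x, y) ->
  Z0 tau (b *m x *m c, invmx c *m y *m invmx b).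
Proof.
move=> ub uc [/= Sx xy yx]; split=> /=; first exact: schub_upper.
- rewrite !mulmxA mulmxK ?uc.2 // -!mulmxA [x *m _]mulmxA mulmxA.
  exact: supper_conj ub.1 xy.
- rewrite -!mulmxA mulKmx ?ub.2 //.
  have := supper_conj (upper_inv uc.1) yx; rewrite invmxK !mulmxA.
  by [].
Qed.

Lemma Z0_scale tau s t x y : s != 0 -> Z0 tau (x, y) -> Z0 tau (s *: x, t *: y).
Proof.
move=> s0 [/= Sx xy yx]; split=> /=.
- move=> i j iq jp; rewrite -Sx // /corner -scalemxAr -scalemxAl.
  by rewrite mxrank_scale_nz.
- by rewrite -scalemxAr -scalemxAl; apply/supper_scale/supper_scale.
- by rewrite -scalemxAr -scalemxAl; apply/supper_scale/supper_scale.
Qed.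

Lemma supper_lin n (a b : 'M[F]_n) t : supper a -> supper b -> supper (a + t *: b).
Proof. by move=> sa sb; apply: supper_add => //; exact: supper_scale. Qed.

Lemma Z0_line tau x y y' t : Z0 tau (x, y) -> Z0 tau (x, y') -> Z0 tau (x, y + t *: y').
Proof.
move=> [/= Sx xy yx] [/= _ xy' yx']; split=> //=.
- by rewrite mulmxDr -scalemxAr; exact: supper_lin.
- by rewrite mulmxDl -scalemxAl; exact: supper_lin.
Qed.

(* The positions with no 1 of [tau] weakly below in the same column nor weakly
   left in the same row: they are the ones missing from the tangent space of
   [schub tau] at [pmx tau]. *)
Definition uncovered tau (a : 'I_p) (b : 'I_q) : bool :=
  [forall k : 'I_p, (a <= k)%N ==> ~~ tau k b] &&
  [forall l : 'I_q, (l <= b)%N ==> ~~ tau a l].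

Lemma mul_pmxl tau n (y : 'M[F]_(q, n)) k l a : partial_perm tau -> tau k l ->
  (pmx F tau *m y) k a = y l a.
Proof.
move=> /partial_permP [H1 H2] t; rewrite mxE (bigD1 l) //= mxE t mul1r.
rewrite big1 ?addr0 // => l' /eqP l'l; rewrite mxE; case t': (tau k l'); last by rewrite mul0r.
by case: l'l; exact: H1 t' t.
Qed.

Lemma mul_pmxl0 tau n (y : 'M[F]_(q, n)) k a : (forall l, ~~ tau k l) ->
  (pmx F tau *m y) k a = 0.
Proof. by move=> t; rewrite mxE big1 // => l _; rewrite mxE (negPf (t l)) mul0r. Qed.

Lemma mul_pmxr tau n (y : 'M[F]_(n, p)) k l a : partial_perm tau -> tau k l ->
  (y *m pmx F tau) a l = y a k.
Proof.
move=> /partial_permP [H1 H2] t; rewrite mxE (bigD1 k) //= mxE t mulr1.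
rewrite big1 ?addr0 // => k' /eqP k'k; rewrite mxE; case t': (tau k' l); last by rewrite mulr0.
by case: k'k; exact: H2 t' t.
Qed.

Lemma mul_pmxr0 tau n (y : 'M[F]_(n, p)) l a : (forall k, ~~ tau k l) ->
  (y *m pmx F tau) a l = 0.
Proof. by move=> t; rewrite mxE big1 // => k _; rewrite mxE (negPf (t k)) mulr0. Qed.

(** Multiplication by a partial permutation matrix only moves entries, so each equation of the fibre
    over [pmx tau] kills a single entry of [y]. *)
Lemma Z0_pmxP tau y : partial_perm tau ->
  Z0 tau (pmx F tau, y) <-> forall a b, ~~ uncovered tau a b -> y b a = 0.
Proof.
move=> tauP; split=> [[/= _ xy yx] a b | H].
  rewrite negb_and => /orP[] /forallPn [k]; rewrite negb_imply negbK => /andP[le t].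
    by rewrite -(mul_pmxl _ _ tauP t) xy.
  by rewrite -(mul_pmxr _ _ tauP t) yx.
split=> /=; first exact: pmx_schub.
- move=> k a ak; have [/existsP [l t]|/existsPn t] := boolP [exists l, tau k l]; last first.
    by rewrite mul_pmxl0.
  rewrite (mul_pmxl _ _ tauP t); apply: H; rewrite negb_and; apply/orP; left.
  by apply/forallPn; exists k; rewrite ak t.
- move=> b l lb; have [/existsP [k t]|/existsPn t] := boolP [exists k, tau k l]; last first.
    by rewrite mul_pmxr0.
  rewrite (mul_pmxr _ _ tauP t); apply: H; rewrite negb_and; apply/orP; right.
  by apply/forallPn; exists l; rewrite lb t.
Qed.

Lemma Z0_delta tau a b : partial_perm tau -> uncovered tau a b ->
  Z0 tau (pmx F tau, delta_mx b a).
Proof.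
move=> tauP fab; apply/(Z0_pmxP _ tauP) => a' b'; rewrite mxE.
by case: eqP => // ->; case: eqP => // ->; rewrite fab.
Qed.

(** A 1 weakly below (a, b) in its column lets a row operation produce that entry, a 1 weakly to the
    left in its row lets a column operation do it. [u] produces all entries of the first kind, and
    [v] those that remain in [m1]. *)
Lemma free_decomposition tau m : partial_perm tau ->
  (forall a b, uncovered tau a b -> m a b = 0) ->
  exists (u : 'M_p) (v : 'M_q), [/\ upper u, upper v & m = u *m pmx F tau + pmx F tau *m v].
Proof.
move=> tauP m0.
pose u : 'M_p := \matrix_(a, k) \sum_b m a b *+ (tau k b && (a <= k)%N).
pose m1 := m - u *m pmx F tau.
pose v : 'M_q := \matrix_(l, b) \sum_a m1 a b *+ (tau a l && (l <= b)%N).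
have [H1 H2] := (partial_permP tau).1 tauP.
exists u, v; split.
- move=> a k ka; rewrite mxE big1 // => b _.
  by rewrite [(a <= k)%N]leqNgt ka andbF.
- move=> l b bl; rewrite mxE big1 // => a _.
  by rewrite [(l <= b)%N]leqNgt bl andbF.
apply/eqP; rewrite addrC -subr_eq -/m1; apply/eqP/matrixP => a b.
have m1E : m1 a b = m a b *+ [forall k : 'I_p, (a <= k)%N ==> ~~ tau k b].
  rewrite [LHS]mxE [X in _ + X]mxE.
  have [/existsP [k t]|/existsPn t] := boolP [exists k, tau k b]; last first.
    rewrite mul_pmxr0 // subr0 (_ : [forall _, _]) //.
    by apply/forallP => k; rewrite t implybT.
  rewrite (mul_pmxr _ _ tauP t) mxE (bigD1 b) //= t big1 => [|b' /eqP b'b]; last first.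
    by case t': (tau k b'); rewrite ?mulr0n //; case: b'b; exact: H1 t' t.
  rewrite addr0 /=; have -> : [forall k : 'I_p, (a <= k)%N ==> ~~ tau k b] = ~~ (a <= k)%N.
    apply/forallP/negP => [/(_ k)|nak k']; first by rewrite t /= implybF => /negP.
    by apply/implyP => ak'; apply/negP => t'; apply: nak; rewrite (H2 _ _ _ t t').
  by case: (a <= k)%N; rewrite ?mulr0n ?subr0 ?mulr1n ?subrr.
have [/existsP [l t]|/existsPn t] := boolP [exists l, tau a l]; last first.
  rewrite mul_pmxl0 // m1E; case c: [forall _, _]; last by rewrite mulr0n.
  rewrite m0 ?mul0rn // /uncovered c /=.
  by apply/forallP => l; rewrite t implybT.
rewrite (mul_pmxl _ _ tauP t) [v l b]mxE (bigD1 a) //= t big1 => [|a' /eqP a'a]; last first.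
  by case t': (tau a' l); rewrite ?mulr0n //; case: a'a; exact: H2 t' t.
rewrite addr0 /=; case lb: (l <= b)%N; first by rewrite mulr1n.
rewrite mulr0n m1E; case c: [forall _, _]; last by rewrite mulr0n.
rewrite m0 ?mul0rn // /uncovered c /=.
apply/forallP => l'; apply/implyP => l'b; apply/negP => t'.
by move: lb; rewrite (H1 _ _ _ t t') l'b.
Qed.

Lemma poly1fun_det_line n (u : 'M[F]_n) : poly1fun (fun t => \det (1%:M + t *: u)).
Proof.
apply: sub_det (poly1fun_subalgebra F) _ _ _.
apply: mx_in_add (poly1fun_subalgebra F) _ _ _ _ _ _; first exact: mx_in_cst (poly1fun_subalgebra F) _ _ _.
apply: mx_in_scale (poly1fun_subalgebra F) _ _ _ _ _ _; first exact: poly1fun_id.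
exact: mx_in_cst (poly1fun_subalgebra F) _ _ _.
Qed.

Lemma schub_line tau x u v t : upper u -> upper v -> schub tau x ->
  \det (1%:M + t *: u) * \det (1%:M + t *: v) <> 0 ->
  schub tau ((1%:M + t *: u) *m x *m (1%:M + t *: v)).
Proof.
move=> uu uv Sx /eqP; rewrite mulf_eq0 negb_or => /andP[du dv].
by apply: schub_upper => //; split; rewrite ?unitmxE ?unitfE //;
  apply: upper_add; [exact: upper1 | exact: upper_scale | exact: upper1 | exact: upper_scale].
Qed.

Lemma mx_deriv_schub_line x u v :
  mx_deriv (fun t => (1%:M + t *: u) *m x *m (1%:M + t *: v)) 0 (u *m x + x *m v).
Proof.
have := mx_deriv_mul (mx_deriv_mul (mx_deriv_line 0 1%:M u) (mx_deriv_cst 0 x))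
  (mx_deriv_line 0 1%:M v).
by rewrite !scale0r !addr0 !mulmx0 !mulmx1 !mul1mx addr0.
Qed.

Lemma tangent_schub tau x u v : upper u -> upper v -> schub tau x ->
  tangent (schub tau) x (u *m x + x *m v).
Proof.
move=> uu uv Sx; have := tangent_curve (A := schub tau)
  (d := fun t => \det (1%:M + t *: u) * \det (1%:M + t *: v))
  (map_deriv_mx (mx_deriv_schub_line x u v)).
rewrite !scale0r !addr0 mul1mx mulmx1; apply.
- exact: sub_mul (poly1fun_subalgebra F) _ _ (poly1fun_det_line u) (poly1fun_det_line v).
- by rewrite !det1 mulr1; apply/eqP; exact: oner_neq0.
- by move=> s; exact: schub_line.
Qed.

(* The minor on the rows and columns of the 1s strictly south-west of (a, b),
   bordered by row a and column b, vanishes on the orbit, and its differential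
   at [pmx tau] is [m a b]. *)
Lemma tangent_pmx_free tau m a b : partial_perm tau ->
  tangent (schub tau) (pmx F tau) m -> uncovered tau a b -> m a b = 0.
Proof.
move=> tauP Tm /andP[/forallP fa /forallP fb].
have [H1 H2] := (partial_permP tau).1 tauP.
pose tau' := restr b.+1 a tau.
have tau'P : partial_perm tau' by exact: restr_partial_perm.
set s := #|{: one_pos tau'}|.
pose A : 'M[F]_(1 + s, p) := col_mx (delta_mx 0 a) (one_rows F tau').
pose C : 'M[F]_(q, 1 + s) := row_mx (delta_mx b 0) (one_cols F tau').
have corner_mul n n' (A' : 'M_(n, p)) (C' : 'M_(q, n')) x :
   (forall i (k : 'I_p), (k < a)%N -> A' i k = 0) -> (forall (l : 'I_q) j, (b < l)%N -> C' l j = 0) ->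
   A' *m x *m C' = A' *m corner b.+1 a x *m C'.
  move=> hA hC; apply/matrixP => i j; rewrite !mxE; apply: eq_bigr => l _.
  have [bl|lb] := ltnP b l; first by rewrite hC // !mulr0.
  congr (_ * _); rewrite !mxE; apply: eq_bigr => k _; rewrite cornerE ltnS lb andbT.
  by have [ka|ak] := ltnP k a; rewrite ?mulr1n // hA // !mul0r.
have Alow i (k : 'I_p) : (k < a)%N -> A i k = 0.
  move=> ka; rewrite mxE; case: splitP => i' _; rewrite mxE.
    by rewrite -[k == a]val_eqE /= ltn_eqF // andbF.
  case: eqP => // kE; have := valP (enum_val i'); rewrite -kE mxE => /andP[/andP[_]].
  by rewrite leqNgt ka.
have Chigh (l : 'I_q) j : (b < l)%N -> C l j = 0.
  move=> bl; rewrite mxE; case: splitP => j' _; rewrite mxE.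
    by rewrite -[l == b]val_eqE /= gtn_eqF.
  case: eqP => // lE; have := valP (enum_val j'); rewrite -lE mxE => /andP[_].
  by rewrite ltnS leqNgt bl.
pose f x := \det (A *m x *m C).
have pf : polyfun 'M[F]_(p, q) f.
  apply: sub_det (polyfun_subalgebra _) _ _ _.
  apply: mx_in_mul (polyfun_subalgebra _) _ _ _ _ _ _ _; last exact: mx_in_cst (polyfun_subalgebra _) _ _ _.
  apply: mx_in_mul (polyfun_subalgebra _) _ _ _ _ _ _ _; first exact: mx_in_cst (polyfun_subalgebra _) _ _ _.
  exact: mx_in_map (polyfun_subalgebra _) _ _ _ (@map_in_id F _).
have f0 x : schub tau x -> f x = 0.
  move=> Sx; have rE : \rank (corner b.+1 a x) = s.
    rewrite Sx ?(ltnW (ltn_ord a)) // -(rank_corner_pmx F _ _ tauP) corner_pmx.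
    by rewrite rank_pmx.
  by apply: contrapT; rewrite /f corner_mul // => /rank_ge_det; rewrite rE ltnn.
have ACE x : A *m x *m C = block_mx (delta_mx 0 a *m x *m delta_mx b 0)
    (delta_mx 0 a *m x *m one_cols F tau')
    (one_rows F tau' *m x *m delta_mx b 0)
    (one_rows F tau' *m x *m one_cols F tau').
  by rewrite /A /C mul_col_mx mul_col_row.
have AC0 : A *m pmx F tau *m C = block_mx 0 0 0 1%:M.
  rewrite corner_mul // corner_pmx -/tau' ACE one_rows_pmx_cols //; congr block_mx.
  - apply/matrixP => i j; rewrite -rowE -colE !mxE.
    by move: (fa a); rewrite leqnn /= => /negPf ->.
  - apply/matrixP => i j; rewrite mul_one_cols -rowE !mxE.
    have := valP (enum_val j); rewrite mxE => /andP[_ lb].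
    by move: (fb (val (enum_val j)).2); rewrite -ltnS lb /= => /negPf ->.
  - apply/matrixP => i j; rewrite -mulmxA mul_one_rows -colE !mxE.
    have := valP (enum_val i); rewrite mxE => /andP[/andP[_ ka] _].
    by move: (fa (val (enum_val i)).1); rewrite ka /= => /negPf ->.
(* The first row of the bordered matrix at [pmx tau + t *: m] is divisible by [t], and [h t] is what
   remains after the division. The derivative of [t * \det (h t)] at 0 is then [\det (h 0)]. *)
pose h t : 'M[F]_(1 + s) := block_mx (delta_mx 0 a *m m *m delta_mx b 0)
    (delta_mx 0 a *m m *m one_cols F tau')
    (t *: (one_rows F tau' *m m *m delta_mx b 0))
    (1%:M + t *: (one_rows F tau' *m m *m one_cols F tau')).
have fh t : f (pmx F tau + t *: m) = t * \det (h t).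
  rewrite /f mulmxDr mulmxDl AC0 -scalemxAr -scalemxAl ACE scale_block_mx.
  rewrite add_block_mx !add0r.
  have -> : t * \det (h t) = \det (block_mx t%:M 0 0 1%:M *m h t).
    by rewrite det_mulmx det_ublock det_scalar det1 mulr1 expr1.
  rewrite mulmx_block !mul0mx !mul_scalar_mx !addr0 add0r.
  by rewrite !scale1r !add0r.
have [c dh] : exists c, has_deriv (fun t => \det (h t)) 0 c.
  apply: poly1fun_has_deriv; apply: sub_det (poly1fun_subalgebra F) _ _ _.
  apply: mx_in_block; try exact: mx_in_cst (poly1fun_subalgebra F) _ _ _.
    apply: mx_in_scale (poly1fun_subalgebra F) _ _ _ _ (poly1fun_id F) _.
    exact: mx_in_cst (poly1fun_subalgebra F) _ _ _.
  apply: mx_in_add (poly1fun_subalgebra F) _ _ _ _ _ _; first exact: mx_in_cst (poly1fun_subalgebra F) _ _ _.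
  apply: mx_in_scale (poly1fun_subalgebra F) _ _ _ _ (poly1fun_id F) _.
  exact: mx_in_cst (poly1fun_subalgebra F) _ _ _.
have := has_deriv_mul (has_deriv_id 0) dh.
rewrite mul1r mul0r addr0 => dfh.
have : \det (h 0) = 0.
  apply: (tangentP Tm pf f0); have -> // : (fun t => f (pmx F tau + t *: m)) = (fun t => t * \det (h t)).
  by apply/funext.
rewrite /h !scale0r addr0 det_ublock det1 mulr1 det_mx11 -rowE -colE !mxE.
by [].
Qed.


End ConormalFibre.

Section ConormalSchub.
Variables (F : numFieldType) (p q : nat).
Implicit Types (tau : 'M[bool]_(p, q)) (x m : 'M[F]_(p, q)) (y : 'M[F]_(q, p)).

Lemma tangent_schub_conj tau b c x m : upper_unitmx b -> upper_unitmx c ->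
  tangent (schub tau) x m -> tangent (schub tau) (b *m x *m c) (b *m m *m c).
Proof.
move=> ub uc; apply: (tangent_linear (u := fun x => b *m x *m c)).
  by move=> t u v; rewrite mulmxDr mulmxDl -scalemxAr -scalemxAl.
by move=> z; exact: schub_upper.
Qed.

(** After translation to [pmx tau] the two factors have disjoint supports: [m] vanishes at the
    uncovered positions and [y] at the covered ones. *)
Lemma Z0_tangent_tr tau x y m : partial_perm tau -> Z0 tau (x, y) ->
  tangent (schub tau) x m -> \tr (m *m y) = 0.
Proof.
move=> tauP Z Tm.
have [/= Sx _ _] := Z; have [b [c [ub uc xE]]] := schub_orbit tauP Sx.
have ubi := upper_unitmx_inv ub; have uci := upper_unitmx_inv uc.
have xE' : invmx b *m x *m invmx c = pmx F tau.
  by rewrite xE !mulmxA mulVmx ?ub.2 // mul1mx mulmxK ?uc.2.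
have := Z0_conj ubi uci Z; rewrite xE' !invmxK => /(Z0_pmxP _ tauP) y0.
have := tangent_schub_conj ubi uci Tm; rewrite xE' => /tangent_pmx_free m0.
have -> : \tr (m *m y) = \tr ((invmx b *m m *m invmx c) *m (c *m y *m b)).
  rewrite mxtrace_mulC [RHS]mxtrace_mulC !mulmxA mulmxK ?ub.2 //.
  rewrite -!mulmxA [RHS]mxtrace_mulC !mulmxA -!mulmxA mulVmx ?uc.2 // mulmx1.
  by [].
rewrite /mxtrace big1 // => a _; rewrite mxE big1 // => l _.
have [fr|/y0 ->] := boolP (uncovered tau a l); last by rewrite mulr0.
by rewrite m0 // mul0r.
Qed.

Lemma tr_delta r k (M : 'M[F]_(k, r)) i j : \tr (delta_mx i j *m M) = M j i.
Proof.
rewrite /mxtrace (bigD1 i) //= big1 => [|a /negPf ai]; last first.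
  by rewrite mxE big1 // => l _; rewrite mxE ai mul0r.
rewrite addr0 mxE (bigD1 j) //= mxE !eqxx mul1r big1 ?addr0 // => l /negPf lj.
by rewrite mxE lj andbF mul0r.
Qed.

Lemma upper_delta n (i j : 'I_n) : (i <= j)%N -> upper (delta_mx i j : 'M[F]_n).
Proof.
move=> ij k l lk; rewrite mxE; case: eqP => //= ki; case: eqP => //= lj.
by move: lk; rewrite ki lj ltnNge ij.
Qed.

Lemma conormal_schub tau : partial_perm tau -> conormal (@schub F p q tau) = Z0 tau.
Proof.
move=> tauP; apply/seteqP; split=> -[x y]; last first.
  move=> Z; split; first by case: Z.
  by move=> m Tm; exact: Z0_tangent_tr tauP Z Tm.
move=> [/= Sx Tx]; split=> //= i j ji.
  (* The entry (i, j) of [x *m y] is the pairing of [y] with [delta_mx j i *m x], which is tangent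
     to the orbit exactly because [delta_mx j i] is upper triangular. *)
  rewrite -tr_delta mulmxA; apply: Tx.
  have := tangent_schub (upper_delta ji) (_ : upper (0 : 'M_q)) Sx.
  by rewrite mulmx0 addr0; apply=> ? ? _; rewrite mxE.
rewrite -tr_delta mulmxA mxtrace_mulC mulmxA; apply: Tx.
have := tangent_schub (_ : upper (0 : 'M_p)) (upper_delta ji) Sx.
by rewrite mul0mx add0r; apply=> ? ? _; rewrite mxE.
Qed.

Lemma Z0_tangent_fibre tau x y y' : Z0 tau (x, y) -> Z0 tau (x, y') ->
  tangent (Z0 tau) (x, y) (0, y').
Proof.
move=> Z Z'.
have dh := map_deriv_pair (map_deriv_line 0 x 0) (map_deriv_line 0 y y').
have := tangent_curve (A := Z0 tau) (d := fun=> 1) dh.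
rewrite !scale0r !addr0; apply.
- exact: sub_cst (poly1fun_subalgebra F) _.
- by apply/eqP; exact: oner_neq0.
- by move=> s _; rewrite scaler0 addr0; exact: Z0_line.
Qed.

End ConormalSchub.

(** * Polynomial sections of kernels of constant rank *)

Section ConstantRank.
Variables (F : fieldType) (V : vectType F) (m n : nat) (M : V -> 'M[F]_(m, n)).
Hypothesis polyM : mx_in (polyfun V) M.

(* Cramer's rule on a maximal invertible minor extends a kernel vector at [a0]
   polynomially; the leading factor [d] kills the extension where that minor
   degenerates. *)
Lemma kernel_section (A : set V) a0 (z0 : 'rV[F]_m) :
  (forall a, A a -> \rank (M a) = \rank (M a0)) -> z0 *m M a0 = 0 ->
  exists z : V -> 'rV[F]_m,
    [/\ mx_in (polyfun V) z, z a0 = z0 & forall a, A a -> z a *m M a = 0].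
Proof.
move=> rk z0M; have [B [C BMC]] := rank_witness (M a0).
pose D a := B *m M a *m C; pose d a := \det (D a).
pose z a := d a *: (d a *: z0 - z0 *m M a *m C *m \adj (D a) *m B).
have subV := polyfun_subalgebra V.
have pD : mx_in (polyfun V) D.
  apply: mx_in_mul => //; last exact: mx_in_cst.
  by apply: mx_in_mul => //; exact: mx_in_cst.
exists z; split.
- apply: mx_in_scale => //; first exact: sub_det.
  apply: mx_in_add => //; first by apply: mx_in_scale => //; [exact: sub_det | exact: mx_in_cst].
  apply: mx_in_opp => //; apply: mx_in_mul => //; last exact: mx_in_cst.
  apply: mx_in_mul => //; last exact: mx_in_adj.
  apply: mx_in_mul => //; last exact: mx_in_cst.
  by apply: mx_in_mul => //; exact: mx_in_cst.
- by rewrite /z z0M !mul0mx subr0 /d /D BMC det1 !scale1r.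
- move=> a Aa; rewrite /z -scalemxAl.
  have [->|d0] := eqVneq (d a) 0; first by rewrite scale0r.
  suff -> : (d a *: z0 - z0 *m M a *m C *m \adj (D a) *m B) *m M a = 0 by rewrite scaler0.
  (* Where [d a] is nonzero, [M a *m C] has the full rank of [M a], so its columns span those of
     [M a]; it suffices to annihilate [M a *m C]. *)
  have /submxP [K ME] : ((M a)^T <= (M a *m C)^T)%MS.
    have rC : (\rank (M a *m C) <= \rank (M a))%N by exact: mxrankM_maxl.
    have rD : (\rank (M a) <= \rank (M a *m C))%N.
      rewrite rk //; apply: leq_trans (mxrankM_maxr B _); rewrite mulmxA.
      by apply: (rank_ge_det (A := 1%:M) (C := 1%:M)); rewrite mul1mx mulmx1; apply/eqP.
    rewrite -(geq_leqif (mxrank_leqif_sup _)) ?mxrank_tr //.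
    by rewrite trmx_mul submxMl.
  have {}ME : M a = M a *m C *m K^T by rewrite -[LHS]trmxK ME trmx_mul trmxK.
  rewrite [X in _ *m X]ME mulmxA mulmxBl -scalemxAl.
  suff -> : d a *: (z0 *m (M a *m C)) - z0 *m M a *m C *m \adj (D a) *m B *m (M a *m C) = 0.
    by rewrite mul0mx.
  rewrite -(mulmxA _ B) [B *m _]mulmxA -/(D a) -[_ *m \adj _ *m _]mulmxA mul_adj_mx.
  by rewrite mul_mx_scalar mulmxA subrr.
Qed.

End ConstantRank.

Section ConormalSection.
Variables (F : numFieldType) (p q : nat).
Implicit Types (tau : 'M[bool]_(p, q)) (x m : 'M[F]_(p, q)) (y : 'M[F]_(q, p)).

Definition low n (a : 'M[F]_n) : 'M[F]_n := \matrix_(i, j) (a i j *+ (j <= i)%N).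

Lemma low_eq0 n (a : 'M[F]_n) : low a = 0 <-> supper a.
Proof.
split=> [/matrixP a0 i j ji | sa]; first by move: (a0 i j); rewrite !mxE ji mulr1n.
by apply/matrixP => i j; rewrite !mxE; case: leqP => [/sa ->|_]; rewrite ?mul0rn ?mulr0n.
Qed.

(** For fixed [x] the conditions on [y] are linear. Writing them on row vectors presents the fibre
    over [x] as the left kernel of a matrix polynomial in [x], the form required by
    [kernel_section]. *)
Definition conormal_eqs x (u : 'rV[F]_(q * p)) : 'rV[F]_(p * p + q * q) :=
  row_mx (mxvec (low (x *m vec_mx u))) (mxvec (low (vec_mx u *m x))).

Lemma conormal_eqs_linear x : linear (conormal_eqs x).
Proof.
have lowD n t (a b : 'M[F]_n) : low (t *: a + b) = t *: low a + low b.
  by apply/matrixP => i j; rewrite !mxE mulrnDl mulrnAr.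
move=> t u v; rewrite /conormal_eqs ![vec_mx _]linearP mulmxDr mulmxDl -scalemxAr -scalemxAl.
by rewrite !lowD ![mxvec _]linearP scale_row_mx add_row_mx.
Qed.

HB.instance Definition _ x :=
  GRing.isLinear.Build F _ _ _ (conormal_eqs x) (conormal_eqs_linear x).

Definition conormal_mx x : 'M[F]_(q * p, p * p + q * q) := lin1_mx (conormal_eqs x).

Lemma conormal_mxP x y : mxvec y *m conormal_mx x = 0 <-> supper (x *m y) /\ supper (y *m x).
Proof.
rewrite mul_rV_lin1 /= /conormal_eqs mxvecK -!low_eq0; split=> [|[-> ->]]; last first.
  by rewrite !linear0 row_mx0.
rewrite -row_mx0 => /eq_row_mx [e1 e2].
by split; apply: (can_inj mxvecK); rewrite linear0.
Qed.

Lemma conormal_mx_poly : mx_in (polyfun 'M[F]_(p, q)) conormal_mx.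
Proof.
have subV := polyfun_subalgebra 'M[F]_(p, q).
have pid : mx_in (polyfun 'M[F]_(p, q)) id by apply: mx_in_map => //; exact: map_in_id.
have plow n (a : 'M[F]_(p, q) -> 'M[F]_n) i j : mx_in (polyfun 'M[F]_(p, q)) a ->
    polyfun 'M[F]_(p, q) (fun x => low (a x) i j).
  move=> pa; under eq_fun do rewrite mxE -mulr_natr.
  by apply: sub_mul => //; exact: sub_cst.
move=> i j; under eq_fun do rewrite mxE.
case: (split_ordP j) => k ->; case/mxvec_indexP: k => a b.
- under eq_fun do rewrite row_mxEl mxvecE.
  by apply: plow; apply: mx_in_mul => //; exact: mx_in_cst.
- under eq_fun do rewrite row_mxEr mxvecE.
  by apply: plow; apply: mx_in_mul => //; exact: mx_in_cst.
Qed.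

(** Conjugation embeds the fibre over [x] into the fibre over [b *m x *m c]; a larger kernel means a
    smaller rank. *)
Lemma rank_conormal_mx_conj b c x : upper_unitmx b -> upper_unitmx c ->
  (\rank (conormal_mx (b *m x *m c)) <= \rank (conormal_mx x))%N.
Proof.
move=> ub uc; pose act y := invmx c *m y *m invmx b.
have act_lin : linear act.
  by move=> t y y'; rewrite /act mulmxDr mulmxDl -scalemxAr -scalemxAl.
pose actL : {linear 'M[F]_(q, p) -> 'M[F]_(q, p)} :=
  HB.pack act (GRing.isLinear.Build _ _ _ _ _ act_lin).
have T_free : row_free (lin_mx actL).
  apply: inj_row_free => u; rewrite -[u]vec_mxK mul_vec_lin -(linear0 mxvec) => /(can_inj mxvecK) /= u0.
  have : c *m act (vec_mx u) *m b = 0 by rewrite u0 mulmx0 mul0mx.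
  rewrite /act !mulmxA mulmxV ?uc.2 // mul1mx -mulmxA mulVmx ?ub.2 // mulmx1 => ->.
  by rewrite linear0.
rewrite -(leq_sub2lE _ (rank_leq_row _)) -!mxrank_ker -(mxrankMfree _ T_free).
apply/mxrankS/sub_kermxP/row_matrixP => i.
rewrite -mulmxA row_mul row0 -[row i _]vec_mxK mulmxA mul_vec_lin /=.
have : row i (kermx (conormal_mx x)) *m conormal_mx x = 0.
  by apply/sub_kermxP; exact: row_sub.
rewrite -{1}[row i _]vec_mxK => /conormal_mxP; move: (vec_mx _) => y [xy yx].
apply/conormal_mxP; rewrite /act; split.
- rewrite !mulmxA mulmxK ?uc.2 // -!mulmxA [x *m _]mulmxA mulmxA.
  exact: supper_conj ub.1 xy.
- rewrite -!mulmxA mulKmx ?ub.2 //.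
  have := supper_conj (upper_inv uc.1) yx; rewrite invmxK !mulmxA.
  by [].
Qed.

(** The rank of [conormal_mx] is constant along the orbit. The section serves twice: for tau, to
    lift a curve in the cell; for sigma, to extend a direction to a vector field. *)
Lemma Z0_section tau x y : partial_perm tau -> Z0 tau (x, y) ->
  exists n : 'M[F]_(p, q) -> 'M[F]_(q, p),
    [/\ map_in (polyfun 'M[F]_(p, q)) n, n x = y &
        forall x', schub tau x' -> Z0 tau (x', n x')].
Proof.
move=> tauP [/= Sx xy yx].
have [||z [pz z0 zP]] := @kernel_section _ _ _ _ _ conormal_mx_poly (schub tau) x (mxvec y).
- move=> x' Sx'.
  have [b [c [ub uc ->]]] := schub_orbit tauP Sx.
  have [b' [c' [ub' uc' ->]]] := schub_orbit tauP Sx'.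
  have E b1 c1 : upper_unitmx b1 -> upper_unitmx c1 ->
      \rank (conormal_mx (b1 *m pmx F tau *m c1)) = \rank (conormal_mx (pmx F tau)).
    move=> ub1 uc1; apply/eqP; rewrite eqn_leq rank_conormal_mx_conj //=.
    have := rank_conormal_mx_conj (b1 *m pmx F tau *m c1) (upper_unitmx_inv ub1) (upper_unitmx_inv uc1).
    by rewrite !mulmxA mulVmx ?ub1.2 // mul1mx mulmxK ?uc1.2.
  by apply: etrans (E _ _ ub' uc') (esym (E _ _ ub uc)).
- by apply/conormal_mxP.
exists (fun x => vec_mx (z x)); split.
- apply: map_in_linear; [exact: polyfun_subalgebra | exact: linearP |].
  apply: map_in_mx => //; exact: polyfun_subalgebra.
- by rewrite z0 mxvecK.
- move=> x' Sx'; have := zP x' Sx'; rewrite -{1}[z x']vec_mxK => /conormal_mxP [? ?].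
  by split.
Qed.

End ConormalSection.

(** * Duality over fixed flags *)

Section Semicontinuity.
Variables (F : numFieldType) (p q : nat).
Implicit Types (tau : 'M[bool]_(p, q)) (x : 'M[F]_(p, q)).

(** Semicontinuity of all corner ranks at once: a product over the finitely many corners gives a
    single polynomial, so that openness near [x0] becomes the nonvanishing of [d]. *)
Lemma rank_detector x0 : exists d : 'M[F]_(p, q) -> F,
  [/\ polyfun _ d, d x0 <> 0 & forall x, d x <> 0 -> forall i j, (i <= q)%N -> (j <= p)%N ->
     (\rank (corner i j x0) <= \rank (corner i j x))%N].
Proof.
have subM := polyfun_subalgebra 'M[F]_(p, q).
have /choice [d dP] : forall ij : 'I_q.+1 * 'I_p.+1, exists d : 'M[F]_(p, q) -> F,
    [/\ polyfun _ d, d x0 <> 0 & forall x, d x <> 0 ->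
       (\rank (corner ij.1 ij.2 x0) <= \rank (corner ij.1 ij.2 x))%N].
  move=> [i j] /=; have [A [C E]] := rank_witness (corner i j x0).
  exists (fun x => \det (A *m corner i j x *m C)); split.
  - apply: sub_det => //; apply: mx_in_mul => //; last exact: mx_in_cst.
    apply: mx_in_mul => //; first exact: mx_in_cst.
    apply: mx_in_mul => //; last exact: mx_in_cst.
    apply: mx_in_mul => //; first exact: mx_in_cst.
    by apply: mx_in_map => //; exact: map_in_id.
  - by rewrite E det1; apply/eqP; exact: oner_neq0.
  - by move=> x; exact: rank_ge_det.
exists (fun x => \prod_ij d ij x); split.
- by apply: sub_prod => // ij _; case: (dP ij).
- by apply/eqP/prodf_neq0 => ij _; apply/eqP; case: (dP ij).
- move=> x /eqP/prodf_neq0 dx i j iq jp.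
  have [_ _ /(_ x)] := dP (Ordinal (iq : (i < q.+1)%N), Ordinal (jp : (j < p.+1)%N)).
  by apply; apply/eqP; exact: dx.
Qed.

Lemma zclosure_schub_le tau x i j : (i <= q)%N -> (j <= p)%N ->
  zclosure (schub tau) x -> (\rank (corner i j x) <= ones i j tau)%N.
Proof.
move=> iq jp Cx; have [d [pd dx dP]] := rank_detector x.
rewrite leqNgt; apply/negP => lt; apply: dx.
apply: (polyfun_zclosure pd Cx) => x' Sx'; apply: contrapT => /dP /(_ i j iq jp).
by rewrite Sx' // leqNgt lt.
Qed.

(** Corner ranks can only drop in the closure, so inside it the lower bounds suffice. With
    [rank_detector] this makes a cell open in its closure. *)
Lemma zclosure_schub_ge tau x : zclosure (schub tau) x ->
  (forall i j, (i <= q)%N -> (j <= p)%N -> (ones i j tau <= \rank (corner i j x))%N) ->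
  schub tau x.
Proof.
move=> Cx H i j iq jp; apply/eqP; rewrite eqn_leq H // andbT.
exact: zclosure_schub_le.
Qed.

End Semicontinuity.

Section Irreducibility.
Variables (F : numFieldType) (p q : nat).
Implicit Types (tau : 'M[bool]_(p, q)) (x m : 'M[F]_(p, q)) (y : 'M[F]_(q, p)).

Lemma invmx_adj n (b : 'M[F]_n) : b \in unitmx -> \adj b = \det b *: invmx b.
Proof.
move=> bu; rewrite /invmx bu scalerA divff ?scale1r //.
by move: bu; rewrite unitmxE unitfE.
Qed.

(* Adjugates instead of inverses make the parametrization of [Z0 tau] polynomial. *)
Lemma Z0_paramP tau x y : partial_perm tau -> Z0 tau (x, y) ->
  exists (b : 'M[F]_p) (c : 'M[F]_q) y0,
    [/\ upper_unitmx b, upper_unitmx c, Z0 tau (pmx F tau, y0),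
        x = b *m pmx F tau *m \adj c & y = c *m y0 *m \adj b].
Proof.
move=> tauP Z; have [/= Sx _ _] := Z.
have [b [c [ub uc xE]]] := schub_orbit tauP Sx.
have ubi := upper_unitmx_inv ub; have uci := upper_unitmx_inv uc.
have dc : \det (invmx c) != 0 by rewrite -unitfE -unitmxE uci.2.
(* The adjugate of [invmx c] is [c] times [\det (invmx c)], and [t] compensates for this factor. The
   inverse determinant in the third witness does the same for the adjugate of [t *: b]. *)
pose t := (\det (invmx c))^-1; have t0 : t != 0 by rewrite invr_neq0.
have utb : upper_unitmx (t *: b).
  split; first exact: upper_scale ub.1.
  by rewrite unitmxZ ?unitfE // ub.2.
have dtb : \det (t *: b) != 0 by rewrite -unitfE -unitmxE utb.2.
exists (t *: b), (invmx c), ((\det (t *: b))^-1 *: (c *m y *m (t *: b))); split=> //.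
- have := Z0_conj ubi uci Z; rewrite !invmxK xE !mulmxA mulVmx ?ub.2 // mul1mx mulmxK ?uc.2 //.
  rewrite -scalemxAr scalerA -{2}[pmx F tau]scale1r.
  exact: Z0_scale (oner_neq0 _).
- rewrite invmx_adj ?uci.2 // invmxK -scalemxAr -!scalemxAl scalerA.
  by rewrite mulfV // scale1r.
- rewrite -scalemxAr -scalemxAl invmx_adj ?utb.2 // -scalemxAr scalerA mulVf // scale1r.
  by rewrite !mulmxA mulVmx ?uc.2 // mul1mx mulmxK // utb.2.
Qed.

Lemma Z0_param tau b c y0 : upper_unitmx b -> upper_unitmx c -> Z0 tau (pmx F tau, y0) ->
  Z0 tau (b *m pmx F tau *m \adj c, c *m y0 *m \adj b).
Proof.
move=> ub uc Z; rewrite !invmx_adj ?ub.2 ?uc.2 // -!scalemxAr.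
apply: Z0_scale; first by rewrite -unitfE -unitmxE uc.2.
by have := Z0_conj ub (upper_unitmx_inv uc) Z; rewrite invmxK.
Qed.

(** The parameters of the two points vary in linear spaces: joining them by segments gives a
    polynomial curve from [z] to [w], and nonzero polynomials on the line have a common point of
    nonvanishing. *)
Lemma Z0_irreducible tau f g (z w : 'M[F]_(p, q) * 'M[F]_(q, p)) : partial_perm tau ->
  polyfun _ f -> polyfun _ g -> Z0 tau z -> Z0 tau w -> f z <> 0 -> g w <> 0 ->
  exists2 u, Z0 tau u & f u <> 0 /\ g u <> 0.
Proof.
move=> tauP pf pg; case: z w => [x y] [x' y'] Zz Zw fz gw.
have [b [c [v [ub uc Zv xE yE]]]] := Z0_paramP tauP Zz.
have [b' [c' [v' [ub' uc' Zv' xE' yE']]]] := Z0_paramP tauP Zw.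
pose bt t := b + t *: (b' - b); pose ct t := c + t *: (c' - c).
pose vt t := v + t *: (v' - v).
pose h t := (bt t *m pmx F tau *m \adj (ct t), ct t *m vt t *m \adj (bt t)).
have subF := poly1fun_subalgebra F.
have pl r k (M N : 'M[F]_(r, k)) : mx_in (@poly1fun F) (fun t => M + t *: N).
  apply: mx_in_add => //; first exact: mx_in_cst.
  by apply: mx_in_scale => //; [exact: poly1fun_id | exact: mx_in_cst].
have ph : map_in (@poly1fun F) h.
  apply: map_in_pair => //; apply: map_in_mx => //; apply: mx_in_mul => //;
    try (by apply: mx_in_adj => //; exact: pl); apply: mx_in_mul => //; try exact: pl.
  exact: mx_in_cst.
have pfh := polyfun_comp subF ph pf; have pgh := polyfun_comp subF ph pg.
pose d t := \det (bt t) * \det (ct t).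
have pd : poly1fun d by apply: sub_mul => //; apply: sub_det => //; exact: pl.
have h0 : h 0 = (x, y) by rewrite /h /bt /ct /vt !scale0r !addr0 xE yE.
have h1 : h 1 = (x', y').
  by rewrite /h /bt /ct /vt !scale1r ![_ + (_ - _)]addrC !subrK xE' yE'.
(* The factor [d] keeps the triangular parameters invertible at the chosen time, so that the point
   lies in [Z0 tau] and not only in its closure. *)
have fd0 : f (h 0) * d 0 <> 0.
  apply/eqP; rewrite mulf_neq0 //; first by rewrite h0; apply/eqP.
  by rewrite /d /bt /ct !scale0r !addr0 mulf_neq0 // -unitfE -unitmxE ?ub.2 ?uc.2.
have gh1 : g (h 1) <> 0 by rewrite h1.
have [s [/eqP fds gs]] := poly1fun_neq0 (sub_mul subF pfh pd) pgh fd0 gh1.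
move: fds; rewrite mulf_eq0 negb_or => /andP[/eqP fs].
rewrite mulf_eq0 negb_or => /andP[dbs dcs].
exists (h s) => //; apply: Z0_param.
- split; last by rewrite unitmxE unitfE.
  apply: upper_add ub.1 _; apply: upper_scale.
  by apply: upper_add ub'.1 _; rewrite -scaleN1r; exact: upper_scale ub.1.
- split; last by rewrite unitmxE unitfE.
  apply: upper_add uc.1 _; apply: upper_scale.
  by apply: upper_add uc'.1 _; rewrite -scaleN1r; exact: upper_scale uc.1.
- apply: Z0_line => //; rewrite -scaleN1r; exact: Z0_line.
Qed.

End Irreducibility.

(** * The two conormal bundles over the standard flags *)

Section Duality.
Variables (F : numFieldType) (p q : nat).
Variables (tau : 'M[bool]_(p, q)) (sigma : 'M[bool]_(q, p)).
Hypotheses (tauP : partial_perm tau) (sigmaP : partial_perm sigma).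
(** Of the duality, transported to the standard flags, two facts are kept: the projection of
    [Z0 tau] lies in the closure of the cell of sigma, and the closure of [Z0 tau] has a point
    projecting into the cell itself. *)
Hypothesis fibre_le : forall (x : 'M[F]_(p, q)) y, Z0 tau (x, y) -> zclosure (schub sigma) y.
Hypothesis fibre_ge : exists (x : 'M[F]_(p, q)) y, zclosure (Z0 tau) (x, y) /\ schub sigma y.
Implicit Types (x m : 'M[F]_(p, q)) (y : 'M[F]_(q, p)).

Definition Zboth : set ('M[F]_(p, q) * 'M[F]_(q, p)) :=
  [set z | Z0 tau z /\ schub sigma z.2].

Lemma Zboth_swap x y : Zboth (x, y) -> Z0 sigma (y, x).
Proof. by move=> [[/= _ xy yx] Sy]; split. Qed.

Lemma detector_schub y0 d y : schub sigma y0 ->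
  (forall y, d y <> 0 -> forall i j, (i <= p)%N -> (j <= q)%N ->
     (\rank (corner i j y0) <= \rank (corner i j y))%N) ->
  zclosure (schub sigma) y -> d y <> 0 :> F -> schub sigma y.
Proof.
move=> Sy0 dP Cy dy; apply: zclosure_schub_ge => // i j ip jq.
by rewrite -Sy0 //; exact: dP.
Qed.

(** The point given by [fibre_ge] lies only in the closure of [Z0 tau]; as the cell of sigma is open
    in its closure, a point of [Z0 tau] projects into it too. *)
Lemma Zboth_nonempty : exists z, Zboth z.
Proof.
have [x [y [Cxy Sy]]] := fibre_ge; have [d [pd dy dP]] := rank_detector y.
have pd2 : polyfun ('M[F]_(p, q) * 'M[F]_(q, p))%type (fun z => d z.2).
  apply: (polyfun_comp (polyfun_subalgebra _) _ pd).
  exact: map_in_snd (polyfun_subalgebra _) _ _ _ (@map_in_id _ _).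
apply: contrapT => nZ; apply: dy; apply: (polyfun_zclosure pd2 Cxy) => -[x' y'] Z /=.
apply: contrapT => dy'; apply: nZ; exists (x', y'); split=> //=.
exact: detector_schub Sy dP (fibre_le Z) dy'.
Qed.

(** [Zboth] is a nonempty open part of [Z0 tau], which is irreducible. *)
Lemma Zboth_dense : Z0 tau `<=` zclosure Zboth.
Proof.
move=> z Zz; apply/zclosureP => f pf f0; apply: contrapT => fz.
have [[x y] [Zxy /= Sy]] := Zboth_nonempty.
have [d [pd dy dP]] := rank_detector y.
have pd2 : polyfun ('M[F]_(p, q) * 'M[F]_(q, p))%type (fun z => d z.2).
  apply: (polyfun_comp (polyfun_subalgebra _) _ pd).
  exact: map_in_snd (polyfun_subalgebra _) _ _ _ (@map_in_id _ _).
have [[x' y'] Z [fu du]] := Z0_irreducible tauP pf pd2 Zz Zxy fz dy.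
by apply: fu; apply: f0; split=> //; exact: detector_schub Sy dP (fibre_le Z) du.
Qed.

Lemma tangent_base_pmx y m : Zboth (pmx F tau, y) -> Z0 sigma (y, m) ->
  tangent (Z0 tau) (pmx F tau, y) (m, 0).
Proof.
move=> [Z /= Sy] Zm; have subF := poly1fun_subalgebra F.
(* Along [y + s *: delta_mx b a] one stays in the fibre of [Z0 tau] over [pmx tau], and in the cell
   of sigma wherever [d] is nonzero. So [delta_mx b a] is tangent to the cell, and its pairing with
   [m] is the entry [m a b]. *)
have m0 a b : uncovered tau a b -> m a b = 0.
  move=> fab; have Zd := Z0_delta F tauP fab.
  rewrite -(tr_delta m b a); apply: (Z0_tangent_tr sigmaP Zm).
  have [d [pd dy dP]] := rank_detector y.
  have dl := map_deriv_line 0 y (delta_mx b a).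
  have := tangent_curve (A := schub sigma) (d := fun t => d (y + t *: delta_mx b a)) dl.
  rewrite !scale0r !addr0; apply=> //.
  - exact: (polyfun_comp subF (map_deriv_in dl) pd).
  - move=> s ds; apply: (detector_schub Sy dP _ ds).
    exact: fibre_le (Z0_line s Z Zd).
have [u [v [uu uv mE]]] := free_decomposition tauP m0.
(* The section through [y], taken along a curve in the cell with velocity [m], lifts this curve to
   [Z0 tau]; [w] will be the second component of the lifted velocity. *)
have [n [pn nx nP]] := Z0_section tauP Z.
pose xt t := (1%:M + t *: u) *m pmx F tau *m (1%:M + t *: v).
pose d t := \det (1%:M + t *: u) * \det (1%:M + t *: v).
have dxt : mx_deriv xt 0 m by rewrite mE; exact: mx_deriv_schub_line.
have xt0 : xt 0 = pmx F tau by rewrite /xt !scale0r !addr0 mul1mx mulmx1.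
have pnx : map_in (@poly1fun F) (fun t => n (xt t)).
  by move=> i; exact: (polyfun_comp subF (map_deriv_in (map_deriv_mx dxt)) (pn i)).
have [w dw] := map_in_deriv 0 pnx.
have pd : poly1fun d by apply: sub_mul subF _ _ (poly1fun_det_line u) (poly1fun_det_line v).
have d0 : d 0 <> 0 by rewrite /d !scale0r !addr0 !det1 mulr1; apply/eqP; exact: oner_neq0.
have Zt s : d s <> 0 -> Z0 tau (xt s, n (xt s)).
  by move=> ds; apply: nP; apply: schub_line => //; exact: pmx_schub.
have [/= _ ym my] := Zm.
(* The Leibniz rule makes [m *m y + pmx F tau *m w] strictly upper triangular, and [m *m y] is so
   because (y, m) lies in [Z0 sigma]; likewise for the products in the other order. *)
have Zw : Z0 tau (pmx F tau, w).
  have dmw := mx_deriv_mul dxt (mx_deriv_map dw).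
  have dwm := mx_deriv_mul (mx_deriv_map dw) dxt.
  rewrite /= xt0 nx in dmw dwm.
  split=> /=; first exact: pmx_schub.
  - have -> : pmx F tau *m w = (m *m y + pmx F tau *m w) + (-1) *: (m *m y).
      by rewrite scaleN1r addrAC subrr add0r.
    apply: supper_lin => // i j ji; apply: (has_deriv_eq0 (dmw i j) pd d0) => s /Zt [/= _ H _].
    exact: H.
  - have -> : w *m pmx F tau = (w *m pmx F tau + y *m m) + (-1) *: (y *m m).
      by rewrite scaleN1r addrK.
    apply: supper_lin => // i j ji; apply: (has_deriv_eq0 (dwm i j) pd d0) => s /Zt [/= _ _ H].
    exact: H.
have -> : (m, 0 : 'M[F]_(q, p)) = (m, w) - (0, w).
  by apply/pair_eqP; rewrite /= subr0 subrr !eqxx.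
apply: tangent_sub; last exact: Z0_tangent_fibre.
have := tangent_curve (map_deriv_pair (map_deriv_mx dxt) dw) pd d0 Zt.
by rewrite /= xt0 nx.
Qed.

Lemma tangent_base x y m : Zboth (x, y) -> Z0 sigma (y, m) ->
  tangent (Z0 tau) (x, y) (m, 0).
Proof.
move=> [Z /= Sy] Zm; have [/= Sx _ _] := Z.
have [b [c [ub uc xE]]] := schub_orbit tauP Sx.
have ubi := upper_unitmx_inv ub; have uci := upper_unitmx_inv uc.
have Z1 := Z0_conj ubi uci Z; rewrite !invmxK xE !mulmxA mulVmx ?ub.2 // mul1mx mulmxK ?uc.2 // in Z1.
have T := tangent_base_pmx (conj Z1 (schub_upper uc ub Sy)) (Z0_conj uc ub Zm).
pose act (z : 'M[F]_(p, q) * 'M[F]_(q, p)) := (b *m z.1 *m c, invmx c *m z.2 *m invmx b).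
have act_lin : linear act.
  move=> t [a1 a2] [b1 b2]; rewrite /act /=; apply/pair_eqP => /=.
  by rewrite !mulmxDr !mulmxDl -!scalemxAr -!scalemxAl !eqxx.
have actP z : Z0 tau z -> Z0 tau (act z) by case: z => ? ?; exact: Z0_conj.
have := tangent_linear act_lin actP T; rewrite /act /= -xE !mulmxA mulVmx ?uc.2 // mul1mx.
rewrite mulmxK ?ub.2 // mulmxV ?ub.2 // mul1mx mulmxKV ?uc.2 //.
by rewrite mulmx0 mul0mx.
Qed.

Lemma schub_transitive y y' : schub sigma y -> schub sigma y' ->
  exists (b : 'M[F]_q) (c : 'M[F]_p),
    [/\ upper_unitmx b, upper_unitmx c & y' = b *m y *m c].
Proof.
move=> /(schub_orbit sigmaP) [b [c [ub uc ->]]] /(schub_orbit sigmaP) [b' [c' [ub' uc' ->]]].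
exists (b' *m invmx b), (invmx c *m c'); split.
- exact: upper_unitmx_mul ub' (upper_unitmx_inv ub).
- exact: upper_unitmx_mul (upper_unitmx_inv uc) uc'.
- by rewrite !mulmxA mulmxKV ?ub.2 // mulmxK ?uc.2.
Qed.

Lemma dual_conormal_sub y x : Z0 sigma (y, x) -> zclosure (Z0 tau) (x, y).
Proof.
move=> Z; apply/zclosureP => f pf f0; have [/= Sy yx xy] := Z.
have [[x1 y1] [Z1 /= Sy1]] := Zboth_nonempty.
have [b [c [ub uc yE]]] := schub_transitive Sy1 Sy.
(* A point of [Zboth] is moved by the group until it lies over the given [y]. *)
pose x0 := invmx c *m x1 *m invmx b.
have Z0xy : Z0 tau (x0, y).
  by have := Z0_conj (upper_unitmx_inv uc) (upper_unitmx_inv ub) Z1; rewrite !invmxK -yE.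
have Zm : Z0 sigma (y, x + (-1) *: x0).
  by apply: Z0_line => //; exact: (@Zboth_swap x0 y (conj Z0xy Sy)).
have [n [pn nx nP]] := Z0_section sigmaP Zm.
set m0 := x + _ in nx Zm.
have subV := polyfun_subalgebra ('M[F]_(p, q) * 'M[F]_(q, p))%type.
pose X (z : 'M[F]_(p, q) * 'M[F]_(q, p)) := (n z.2, 0 : 'M[F]_(q, p)).
have pX : map_in (polyfun _) X.
  apply: map_in_pair => //; last exact: map_in_cst.
  move=> i; apply: (polyfun_comp subV _ (pn i)).
  exact: map_in_snd subV _ _ _ (@map_in_id _ _).
pose line s := (x0 + s *: m0, y).
(* The field [X] depends only on the second component, which is constant on the line from (x0, y) to
   (x, y); hence the line is an integral curve of [X]. *)
have dline s : map_deriv line s (X (line s)).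
  rewrite /X /line /= nx; have := map_deriv_pair (map_deriv_line s x0 m0) (map_deriv_line s y 0).
  by congr map_deriv; apply/funext => t; rewrite scaler0 addr0.
pose I : set (F -> F) := [set phi | exists g, [/\ polyfun _ g,
   forall z, Z0 tau z -> g z = 0 & phi = fun s => g (line s)]].
have /poly1fun_vanish_derivs HI : forall phi, I phi -> [/\ poly1fun phi, phi 0 = 0 &
     exists2 g, I g & forall s, has_deriv phi s (g s)].
  move=> _ [g [pg g0 ->]]; split.
  - exact: (polyfun_comp (poly1fun_subalgebra F) (map_deriv_in (dline 0)) pg).
  - by apply: g0; rewrite /line scale0r addr0.
  - have [g' pg' [dg' g'0]] := directional_derivative pg pX.
    exists (fun s => g' (line s)); last by move=> s; apply: dg'; exact: dline.
    (* Tangency of [X] is known on [Zboth]; density carries the vanishing of [g'] to all of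
       [Z0 tau], so the derivative stays in [I]. *)
    exists g'; split=> // z /Zboth_dense Cz.
    apply: (polyfun_zclosure pg' Cz) => -[x2 y2] Zb; apply: (g'0 (Z0 tau)) => //.
    by apply: tangent_base => //; apply: nP; case: Zb.
have /(HI _)/(congr1 (fun phi => phi 1)) : I (fun s => f (line s)) by exists f.
by rewrite /line /m0 scale1r scaleN1r addrC subrK.
Qed.

Lemma dual_conormal_dense y x : Z0 sigma (y, x) -> zclosure Zboth (x, y).
Proof. by move=> /dual_conormal_sub; apply: zclosure_sub; exact: Zboth_dense. Qed.

End Duality.

(** * Flags and frames *)

Section Frames.
Variables (F : fieldType).

Lemma invmx_mul n (b c : 'M[F]_n) : b \in unitmx -> c \in unitmx ->
  invmx (b *m c) = invmx c *m invmx b.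
Proof.
move=> bu cu; have bcu : b *m c \in unitmx by rewrite unitmx_mul bu.
rewrite -[RHS](mulKmx bcu) -!mulmxA (mulmxA c) mulmxV // mul1mx mulmxV //.
by rewrite mulmx1.
Qed.

Lemma imgE m n (a : 'M[F]_(m, n)) (v : 'cV[F]_n) : linfun (mulmx a) v = a *m v.
Proof. by rewrite lfunE. Qed.

Lemma memv_img_mx m n (a : 'M[F]_(m, n)) (U : {vspace 'cV[F]_n}) v :
  reflect (exists2 u, u \in U & v = a *m u) (v \in img a U).
Proof.
apply: (iffP memv_imgP) => [[u Uu ->]|[u Uu ->]]; exists u => //; by rewrite imgE.
Qed.

Lemma dim_img_full m n (a : 'M[F]_(m, n)) : \dim (img a fullv) = \rank a.
Proof.
have /row_fullP [A HA] := col_base_full a.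
have /row_freeP [C HC] := row_base_free a.
have -> : img a fullv = img (col_base a) fullv.
  apply/vspaceP => v; apply/memv_img_mx/memv_img_mx => -[u _ ->].
    by exists (row_base a *m u); rewrite ?memvf // mulmxA mulmx_base.
  exists (C *m u); rewrite ?memvf //.
  transitivity (col_base a *m row_base a *m (C *m u)); last by rewrite mulmx_base.
  by rewrite -mulmxA [row_base _ *m _]mulmxA HC mul1mx.
rewrite /img limg_dim_eq; first by rewrite dimvf /dim /= muln1.
apply/eqP; rewrite -subv0; apply/subvP => u /memv_capP [_].
rewrite memv_ker imgE => /eqP u0.
by rewrite -[u]mul1mx -HA -mulmxA u0 mulmx0 mem0v.
Qed.

Section FixedSize.
Variable n : nat.
Implicit Types (g : 'M[F]_n) (E : flag F n) (v : 'cV[F]_n).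

Definition colspan g (i : nat) : {vspace 'cV[F]_n} :=
  <<[seq col j g | j : 'I_n <- enum 'I_n & (j < i)%N]>>%VS.

Lemma mem_colspan g i v : g \in unitmx ->
  v \in colspan g i <-> forall k : 'I_n, (i <= k)%N -> (invmx g *m v) k 0 = 0.
Proof.
move=> gu; split=> [vS k ik | H].
  have : v \in lker (linfun (mulmx (copid_mx i *m invmx g)) : 'Hom('cV[F]_n, 'cV[F]_n)).
    suff /subvP : (colspan g i <= lker (linfun (mulmx (copid_mx i *m invmx g)) : 'Hom('cV[F]_n, 'cV[F]_n)))%VS by apply.
    apply/span_subvP => w /mapP [j]; rewrite mem_filter => /andP[ji _] {w}->.
    rewrite memv_ker imgE colE -mulmxA mulKmx //; apply/eqP/matrixP => k' l.
    rewrite copid_mulE !mxE; case: eqP => [->|]; last by rewrite mul0rn.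
    by rewrite leqNgt ji mulr0n.
  rewrite memv_ker imgE => /eqP /matrixP /(_ k 0).
  by rewrite -mulmxA copid_mulE ik mulr1n => ->; rewrite mxE.
have -> : v = \sum_(j < n) (invmx g *m v) j 0 *: col j g.
  rewrite -{1}[v](mulKVmx gu); apply/matrixP => k l; rewrite ord1 summxE mxE.
  by apply: eq_bigr => j _; rewrite !mxE mulrC.
apply: memv_suml => j _; have [ji|ij] := ltnP j i; last by rewrite H // scale0r mem0v.
by apply/memvZ/memv_span/map_f; rewrite mem_filter ji mem_enum.
Qed.

Lemma mem_frame g E i v : frame g E ->
  v \in E i <-> forall k : 'I_n, (i <= k)%N -> (invmx g *m v) k 0 = 0.
Proof. by move=> [gu ->]; exact: mem_colspan. Qed.

Lemma frame_col g E (j : 'I_n) i : frame g E -> (j < i)%N -> col j g \in E i.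
Proof.
move=> fg ji; apply/(mem_frame _ _ fg) => k ik; have [gu _] := fg.
rewrite colE mulKmx // mxE; case: eqP => // kj.
by move: ik; rewrite kj leqNgt ji.
Qed.

Lemma frame_mul g E b : frame g E -> upper_unitmx b -> frame (g *m b) E.
Proof.
move=> fg ub; have [gu _] := fg; have gbu : g *m b \in unitmx by rewrite unitmx_mul gu ub.2.
split=> // i; apply/vspaceP => v; apply/idP/idP => [/(mem_frame _ _ fg) H | /(mem_colspan _ _ gbu) H].
  apply/(mem_colspan _ _ gbu) => k ik; rewrite (invmx_mul gu ub.2) -mulmxA mxE big1 // => l _.
  have [lk|kl] := ltnP l k; first by rewrite (upper_inv ub.1) // mul0r.
  by rewrite H ?mulr0 // (leq_trans ik).
apply/(mem_frame _ _ fg) => k ik.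
have -> : invmx g *m v = b *m (invmx (g *m b) *m v).
  by rewrite (invmx_mul gu ub.2) !mulmxA mulmxV ?ub.2 // mul1mx.
rewrite mxE big1 // => l _.
have [lk|kl] := ltnP l k; first by rewrite ub.1 // mul0r.
by rewrite H ?mulr0 // (leq_trans ik).
Qed.

Lemma frame_change g g' E : frame g E -> frame g' E -> upper_unitmx (invmx g *m g').
Proof.
move=> fg fg'; split; last by rewrite unitmx_mul unitmx_inv fg.1 fg'.1.
move=> i j ji; have /(mem_frame _ _ fg)/(_ i ji) := frame_col fg' (ltnSn j).
by rewrite colE mulmxA -colE mxE.
Qed.

Lemma flag_dim E i : \dim (E i) = minn i n. Proof. by case: E. Qed.

Lemma flag_le E i j : (i <= j)%N -> (E i <= E j)%VS.
Proof.
move=> /subnK <-; elim: (j - i)%N => [|k IH]; first by rewrite subvv.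
by apply: subv_trans IH _; rewrite addSn; case: E.
Qed.

(** Vectors chosen in each [E i.+1] outside [E i] have spans of dimension at least [i], which forces
    them to be the spaces of the flag. The matrix is invertible because its columns span
    everything. *)
Lemma frame_exists E : exists g, frame g E.
Proof.
have /choice [v vP] : forall i : 'I_n, exists v, v \in E i.+1 /\ v \notin E i.
  move=> i; suff /subvPn [v] : ~~ (E i.+1 <= E i)%VS by exists v.
  apply/negP => /dimvS; rewrite !flag_dim (minn_idPl (ltn_ord i)).
  by rewrite (minn_idPl (ltnW (ltn_ord i))) ltnn.
pose g : 'M[F]_n := \matrix_(k, j) v j k 0.
have colg j : col j g = v j by apply/matrixP => k l; rewrite ord1 !mxE.
have le_E i : (colspan g i <= E i)%VS.
  apply/span_subvP => w /mapP [j]; rewrite mem_filter => /andP[ji _] {w}->.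
  by rewrite colg; exact: (subvP (flag_le E ji) _ (vP j).1).
have monoS i j : (i <= j)%N -> (colspan g i <= colspan g j)%VS.
  move=> ij; apply: sub_span => w /mapP [k]; rewrite mem_filter => /andP[ki _] {w}->.
  by apply: map_f; rewrite mem_filter (leq_trans ki) // mem_enum.
have ge_dim i : (i <= n)%N -> (i <= \dim (colspan g i))%N.
  elim: i => // i IH lt_in; apply: leq_ltn_trans (IH (ltnW lt_in)) _.
  rewrite ltn_neqAle dimvS ?monoS // andbT; apply/negP => eq_dim.
  have /eqP S_eq : colspan g i == colspan g i.+1 by rewrite eqEdim monoS //= (eqP eq_dim).
  have /negP := (vP (Ordinal lt_in)).2; apply; apply: (subvP (le_E i)).
  rewrite S_eq -colg; apply/memv_span/map_f.
  by rewrite mem_filter /= ltnSn mem_enum.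
have spanE i : E i = colspan g i.
  apply/esym/eqP; rewrite eqEdim le_E flag_dim /=.
  apply: leq_trans (ge_dim (minn i n) (geq_minr _ _)) _.
  by apply/dimvS/monoS/geq_minl.
exists g; split=> //.
have gW (k : 'I_n) : exists w : 'cV[F]_n, g *m w = delta_mx k 0.
  have : delta_mx k 0 \in img g fullv.
    have : (colspan g n <= img g fullv)%VS.
      apply/span_subvP => _ /mapP [j _ ->]; apply/memv_img_mx.
      by exists (delta_mx j 0); rewrite ?memvf // colE.
    move/subvP; apply; rewrite -spanE.
    have -> : E n = fullv by apply/eqP; rewrite eqEdim subvf flag_dim minnn dimvf /dim /= muln1.
    exact: memvf.
  by move=> /memv_img_mx [w _ ->]; exists w.
have [w wP] := choice gW.
have : g *m (\matrix_(k, j) w j k 0) = 1%:M.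
  apply/matrixP => i j; have /matrixP /(_ i 0) := wP j.
  rewrite !mxE eqxx andbT => <-; by apply: eq_bigr => k _; rewrite !mxE.
by case/mulmx1_unit.
Qed.

Lemma nilpotent_flagP g E (a : 'M[F]_n) : frame g E ->
  (forall i, (i < n)%N -> (img a (E i.+1) <= E i)%VS) <-> supper (invmx g *m a *m g).
Proof.
move=> fg; have [gu _] := fg; split=> [H i j ji | sa i lt_in].
  have : a *m col j g \in E j.
    by apply: (subvP (H j (ltn_ord j))); apply/memv_img_mx; exists (col j g) => //; exact: frame_col.
  by move=> /(mem_frame _ _ fg)/(_ i ji); rewrite colE !mulmxA -colE mxE.
apply/subvP => _ /memv_img_mx [v /(mem_frame _ _ fg) Hv ->].
apply/(mem_frame _ _ fg) => k ik.
have -> : invmx g *m (a *m v) = (invmx g *m a *m g) *m (invmx g *m v).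
  by rewrite !mulmxA mulmxK.
rewrite mxE big1 // => l _.
have [li|il] := leqP l i; first by rewrite sa ?mul0r // (leq_trans li).
by rewrite Hv // mulr0.
Qed.

End FixedSize.

(** The map [phi] has kernel [E2 j], which contributes [j]; the image of the sum under [phi] is that
    of the corner of [x] written in the two frames. *)
Lemma dim_schubert p q (E1 : flag F q) (E2 : flag F p) g h (x : 'M[F]_(p, q)) i j :
  frame g E1 -> frame h E2 -> (j <= p)%N ->
  \dim (img x (E1 i) + E2 j)%VS = (j + \rank (corner i j (invmx h *m x *m g)))%N.
Proof.
move=> fg fh jp; have [gu _] := fg; have [hu _] := fh.
pose phi := (linfun (mulmx (copid_mx j *m invmx h)) : 'Hom('cV[F]_p, 'cV[F]_p)).
have kerE : lker phi = E2 j.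
  apply/vspaceP => v; rewrite memv_ker imgE; apply/idP/idP => [/eqP/matrixP H | /(mem_frame _ _ fh) H].
    apply/(mem_frame _ _ fh) => k jk.
    by have := H k 0; rewrite -mulmxA copid_mulE jk mulr1n => ->; rewrite mxE.
  apply/eqP/matrixP => k l; rewrite -mulmxA copid_mulE ord1 [RHS]mxE.
  by case: leqP => [/H ->|_]; rewrite ?mul0rn ?mulr0n.
rewrite -(limg_ker_dim phi) kerE (capv_idPr (addvSr _ _)) flag_dim (minn_idPl jp).
congr (_ + _)%N; rewrite limgD -kerE.
have -> : (phi @: lker phi)%VS = 0%VS by apply/eqP; rewrite -lkerE.
rewrite addv0 -dim_img_full; congr (\dim _).
apply/vspaceP => v; apply/memv_imgP/memv_img_mx => [[_ /memv_img_mx [u /(mem_frame _ _ fg) Hu ->] ->] | [u _ ->]].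
  exists (invmx g *m u); first exact: memvf.
  rewrite imgE /corner -!mulmxA; congr (_ *m (_ *m (_ *m _))).
  rewrite -{1}[u](mulKVmx gu); congr (_ *m _); apply/matrixP => k l.
  have -> : pid_mx i *m (invmx g *m u) = (invmx g *m u) - copid_mx i *m (invmx g *m u).
    by rewrite mulmxBl mul1mx opprB addrC subrK.
  rewrite [RHS]mxE [X in _ + X]mxE copid_mulE ord1.
  by case: leqP => [/Hu ->|_]; rewrite ?mul0rn ?mulr0n ?subr0 // oppr0 addr0.
exists (x *m (g *m (pid_mx i *m u))); last by rewrite imgE /corner !mulmxA.
apply/memv_img_mx; exists (g *m (pid_mx i *m u)) => //.
apply/(mem_frame _ _ fg) => k ik; rewrite mulKmx // mxE big1 // => l _.
by rewrite mxE; case: eqP => [kl|]; rewrite ?mul0r // ltnNge ik /= mul0r.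
Qed.

Lemma schubert_frame p q (E1 : flag F q) (E2 : flag F p) g h tau (x : 'M[F]_(p, q)) :
  frame g E1 -> frame h E2 ->
  schubert E1 E2 tau x <-> schub tau (invmx h *m x *m g).
Proof.
move=> fg fh; split=> H i j iq jp; have := H i j iq jp.
  by rewrite (dim_schubert _ _ fg fh) // => /addnI.
by rewrite (dim_schubert _ _ fg fh) // => ->.
Qed.

End Frames.

(** * From the standard flags to arbitrary flags *)

Section Transport.
Variables (F : numFieldType).

Lemma conj_exp n (g a : 'M[F]_n) k : g \in unitmx ->
  (invmx g *m a *m g) ^+ k = invmx g *m a ^+ k *m g.
Proof.
move=> gu; elim: k => [|k IH]; first by rewrite !expr0 mulmx1 mulVmx.
rewrite !exprS IH -!mulmxE !mulmxA mulmxK //.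
Qed.

Section OneFlagPair.
Variables (p q : nat) (E1 : flag F q) (E2 : flag F p) (g : 'M[F]_q) (h : 'M[F]_p).
Hypotheses (fg : frame g E1) (fh : frame h E2).
Implicit Types (tau : 'M[bool]_(p, q)) (x : 'M[F]_(p, q)) (y : 'M[F]_(q, p)).

Let gu : g \in unitmx := fg.1.
Let hu : h \in unitmx := fh.1.

Lemma conj_mulxy x y : (invmx h *m x *m g) *m (invmx g *m y *m h) = invmx h *m (x *m y) *m h.
Proof. by rewrite !mulmxA mulmxK. Qed.

Lemma conj_mulyx x y : (invmx g *m y *m h) *m (invmx h *m x *m g) = invmx g *m (y *m x) *m g.
Proof. by rewrite !mulmxA mulmxK. Qed.

Lemma conormal_CP tau x y :
  conormal_C tau ((E1, E2), (x, y)) <-> Z0 tau (invmx h *m x *m g, invmx g *m y *m h).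
Proof.
split=> [[Sx _ yx xy] | [/= Sx xy yx]].
  split=> /=; first exact/(schubert_frame _ _ fg fh).
    by rewrite conj_mulxy; exact/(nilpotent_flagP _ fh).
  by rewrite conj_mulyx; exact/(nilpotent_flagP _ fg).
rewrite conj_mulxy in xy; rewrite conj_mulyx in yx.
split; [exact/(schubert_frame _ _ fg fh) | | exact/(nilpotent_flagP _ fg) | exact/(nilpotent_flagP _ fh)].
have [k] := supper_nilpotent xy; rewrite (conj_exp _ _ hu) => xy0; exists k => /=.
have : h *m (invmx h *m (x *m y) ^+ k *m h) *m invmx h = 0 by rewrite xy0 mulmx0 mul0mx.
by rewrite !mulmxA mulmxV // mul1mx mulmxK.
Qed.

Lemma conormal_schubertP tau x y : partial_perm tau ->
  conormal (schubert E1 E2 tau) (x, y) <-> Z0 tau (invmx h *m x *m g, invmx g *m y *m h).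
Proof.
move=> tauP; rewrite -conormal_schub //.
have to_std : linear (fun z : 'M[F]_(p, q) => invmx h *m z *m g).
  by move=> t a b; rewrite mulmxDr mulmxDl -scalemxAr -scalemxAl.
have of_std : linear (fun z : 'M[F]_(p, q) => h *m z *m invmx g).
  by move=> t a b; rewrite mulmxDr mulmxDl -scalemxAr -scalemxAl.
have toK z : h *m (invmx h *m z *m g) *m invmx g = z.
  by rewrite !mulmxA mulmxV // mul1mx mulmxK.
have ofK z : invmx h *m (h *m z *m invmx g) *m g = z.
  by rewrite !mulmxA mulVmx // mul1mx mulmxKV.
have trE (m : 'M[F]_(p, q)) : \tr ((invmx h *m m *m g) *m (invmx g *m y *m h)) = \tr (m *m y).
  by rewrite conj_mulxy mxtrace_mulC !mulmxA mulmxV // mul1mx.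
have to_schub z : schubert E1 E2 tau z -> schub tau (invmx h *m z *m g).
  by move/(schubert_frame _ _ fg fh).
have of_schub z : schub tau z -> schubert E1 E2 tau (h *m z *m invmx g).
  by move=> Sz; apply/(schubert_frame _ _ fg fh); rewrite ofK.
split=> -[/= Sx Tx]; split=> /=; first exact: to_schub.
- move=> m Tm; rewrite -[m]ofK trE; apply: Tx.
  by have := tangent_linear of_std of_schub Tm; rewrite toK.
- by rewrite -[x]toK; exact: of_schub.
- by move=> m Tm; rewrite -trE; apply: Tx; exact: (tangent_linear to_std to_schub Tm).
Qed.

End OneFlagPair.

Section Dual.
Variables (p q : nat) (tau : 'M[bool]_(p, q)) (sigma : 'M[bool]_(q, p)).
Hypotheses (tauP : partial_perm tau) (sigmaP : partial_perm sigma).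
Variables (E0 : flag F q) (F0 : flag F p).
Hypothesis dual : is_dual E0 F0 tau sigma.

Lemma dual_fibre_le (x : 'M[F]_(p, q)) y : Z0 tau (x, y) -> zclosure (schub sigma) y.
Proof.
have [g fg] := frame_exists E0; have [h fh] := frame_exists F0.
have [gu _] := fg; have [hu _] := fh => Z.
pose X := h *m x *m invmx g; pose Y := g *m y *m invmx h.
have XK : invmx h *m X *m g = x by rewrite /X !mulmxA mulVmx // mul1mx mulmxKV.
have YK : invmx g *m Y *m h = y by rewrite /Y !mulmxA mulVmx // mul1mx mulmxKV.
have : zclosure (schubert F0 E0 sigma) Y.
  rewrite -[zclosure _]dual; exists (X, Y) => //; apply: sub_zclosure.
  by apply/(conormal_schubertP fg fh) => //; rewrite XK YK.
have lin : linear (fun z : 'M[F]_(q, p) => invmx g *m z *m h).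
  by move=> t a b; rewrite mulmxDr mulmxDl -scalemxAr -scalemxAl.
rewrite -YK; apply: (zclosure_linear lin) => z Sz; apply: sub_zclosure.
exact/(schubert_frame _ _ fh fg).
Qed.

Lemma dual_fibre_ge : exists (x : 'M[F]_(p, q)) y,
  zclosure (Z0 tau) (x, y) /\ schub sigma y.
Proof.
have [g fg] := frame_exists E0; have [h fh] := frame_exists F0.
have [gu _] := fg; have [hu _] := fh.
pose Y := g *m pmx F sigma *m invmx h.
have YK : invmx g *m Y *m h = pmx F sigma by rewrite /Y !mulmxA mulVmx // mul1mx mulmxKV.
have : zclosure (schubert F0 E0 sigma) Y.
  apply/sub_zclosure/(schubert_frame _ _ fh fg); rewrite YK; exact: pmx_schub.
rewrite -[zclosure _]dual => -[[X Y'] C /= YE]; rewrite {}YE in C.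
exists (invmx h *m X *m g), (pmx F sigma); split; last exact: pmx_schub.
pose u (z : 'M[F]_(p, q) * 'M[F]_(q, p)) := (invmx h *m z.1 *m g, invmx g *m z.2 *m h).
have lin : linear u.
  move=> t [a1 a2] [b1 b2]; rewrite /u /=; apply/pair_eqP => /=.
  by rewrite !mulmxDr !mulmxDl -!scalemxAr -!scalemxAl !eqxx.
rewrite -YK -[(_, _)]/(u (X, Y)); apply: (zclosure_linear lin _ C) => -[x y] Zxy.
by apply: sub_zclosure; exact/(conormal_schubertP fg fh).
Qed.

Definition conormal_both (E1 : flag F q) (E2 : flag F p) : set ('M[F]_(p, q) * 'M[F]_(q, p)) :=
  [set z | conormal_C tau ((E1, E2), z) /\ conormal_C sigma ((E2, E1), (z.2, z.1))].

Let of_frame (g : 'M[F]_q) (h : 'M[F]_p) (z : 'M[F]_(p, q) * 'M[F]_(q, p)) :=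
  (h *m z.1 *m invmx g, g *m z.2 *m invmx h).

Lemma Zboth_of_frame E1 E2 g h x y : frame g E1 -> frame h E2 ->
  zclosure (Zboth tau sigma) (invmx h *m x *m g, invmx g *m y *m h) ->
  zclosure (conormal_both E1 E2) (x, y).
Proof.
move=> fg fh; have [gu _] := fg; have [hu _] := fh.
have lin : linear (of_frame g h).
  move=> t [a1 a2] [b1 b2]; rewrite /of_frame /=; apply/pair_eqP => /=.
  by rewrite !mulmxDr !mulmxDl -!scalemxAr -!scalemxAl !eqxx.
have K1 (z : 'M[F]_(p, q)) : h *m (invmx h *m z *m g) *m invmx g = z.
  by rewrite !mulmxA mulmxV // mul1mx mulmxK.
have K2 (z : 'M[F]_(q, p)) : g *m (invmx g *m z *m h) *m invmx h = z.
  by rewrite !mulmxA mulmxV // mul1mx mulmxK.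
have K3 (z : 'M[F]_(p, q)) : invmx h *m (h *m z *m invmx g) *m g = z.
  by rewrite !mulmxA mulVmx // mul1mx mulmxKV.
have K4 (z : 'M[F]_(q, p)) : invmx g *m (g *m z *m invmx h) *m h = z.
  by rewrite !mulmxA mulVmx // mul1mx mulmxKV.
move=> C; rewrite -[x]K1 -[y]K2.
have := zclosure_linear (B := conormal_both E1 E2) lin _ C; apply=> -[x1 y1] Z.
apply: sub_zclosure; split=> /=.
  by apply/(conormal_CP fg fh); rewrite K3 K4; case: Z.
by apply/(conormal_CP fh fg); rewrite K3 K4; exact: (Zboth_swap Z).
Qed.

(** Duality is assumed over the single pair [E0], [F0]. Passing through [Z0], which involves only
    the standard flags, gives density over every pair. *)
Lemma conormal_C_dense E1 E2 x y : conormal_C tau ((E1, E2), (x, y)) ->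
  zclosure (conormal_both E1 E2) (x, y).
Proof.
have [g fg] := frame_exists E1; have [h fh] := frame_exists E2.
move=> /(conormal_CP fg fh) Z; apply: (Zboth_of_frame fg fh).
exact: (Zboth_dense tauP dual_fibre_le dual_fibre_ge).
Qed.

Lemma conormal_C_dual_dense E1 E2 x y : conormal_C sigma ((E2, E1), (y, x)) ->
  zclosure (conormal_both E1 E2) (x, y).
Proof.
have [g fg] := frame_exists E1; have [h fh] := frame_exists E2.
move=> /(conormal_CP fh fg) Z; apply: (Zboth_of_frame fg fh).
exact: (dual_conormal_dense tauP sigmaP dual_fibre_le dual_fibre_ge).
Qed.

End Dual.
End Transport.

(** * Closures in the total space over the flag varieties *)

Section PointClosure.
Variable F : numFieldType.

Definition ambient (q p : nat) : Type :=
  (('M[F]_q * 'M[F]_p) * ('M[F]_(p, q) * 'M[F]_(q, p)))%type.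
HB.instance Definition _ q p := Vector.on (ambient q p).

(** [pclosure] provides some pair of frames. Any other pair differs by triangular matrices on the
    right, which act linearly and preserve [frames A]. *)
Lemma pclosure_frames q p (A : set (Defs.point F q p)) z g h :
  pclosure A z -> frame g z.1.1 -> frame h z.1.2 -> zclosure (frames A) ((g, h), z.2).
Proof.
move=> [g' [h' [fg' fh' C]]] fg fh.
pose u (w : ambient q p) : ambient q p :=
  ((w.1.1 *m (invmx g' *m g), w.1.2 *m (invmx h' *m h)), w.2).
have lin : linear u.
  move=> t [[a1 a2] [a3 a4]] [[b1 b2] [b3 b4]]; rewrite /u /=.
  by apply/pair_eqP => /=; rewrite /= !mulmxDl -!scalemxAl !eqxx.
have -> : ((g, h), z.2) = u ((g', h'), z.2).
  by rewrite /u /= !mulmxA !mulmxV ?fg'.1 ?fh'.1 // !mul1mx.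
apply: (zclosure_linear lin _ C) => -[[g1 h1] w] [E1 [E2 [/= f1 f2 Aw]]].
apply: sub_zclosure; exists E1, E2; split=> //=.
- exact: frame_mul f1 (frame_change fg' fg).
- exact: frame_mul f2 (frame_change fh' fh).
Qed.

Definition swap_point q p (z : Defs.point F q p) : Defs.point F p q :=
  ((z.1.2, z.1.1), (z.2.2, z.2.1)).

Definition swap_ambient q p (w : ambient q p) : ambient p q :=
  ((w.1.2, w.1.1), (w.2.2, w.2.1)).

Lemma swap_ambient_linear q p : linear (@swap_ambient q p).
Proof. by move=> t [[a1 a2] [a3 a4]] [[b1 b2] [b3 b4]]. Qed.

(* Density over every fixed pair of flags gives density in the total space. *)
Lemma pclosure_fibrewise q p (A : set (Defs.point F q p)) (B : set (Defs.point F p q)) :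
  (forall E1 E2 x y, A ((E1, E2), (x, y)) ->
     zclosure [set z : 'M[F]_(p, q) * 'M[F]_(q, p) | B ((E2, E1), (z.2, z.1))] (x, y)) ->
  forall z, pclosure A z -> pclosure B (swap_point z).
Proof.
move=> AB [[E1 E2] [x y]] [g [h [/= fg fh C]]]; exists h, g; split=> //=.
rewrite -[((h, g), (y, x))]/(swap_ambient ((g, h), (x, y)) : ambient _ _).
apply: (zclosure_linear (@swap_ambient_linear q p) _ C) => -[[g1 h1] [x1 y1]].
move=> [E1' [E2' [/= f1 f2 /AB Cxy]]]; rewrite /swap_ambient /=.
pose u (z : 'M[F]_(p, q) * 'M[F]_(q, p)) : ambient p q := ((h1, g1), (z.2, z.1)).
have pu : map_in (polyfun _) u.
  have subV := polyfun_subalgebra ('M[F]_(p, q) * 'M[F]_(q, p))%type.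
  apply: map_in_pair => //; first exact: map_in_cst.
  have lin : linear (fun z : 'M[F]_(p, q) * 'M[F]_(q, p) => (z.2, z.1)) by [].
  exact: (map_in_linear subV lin (@map_in_id _ _)).
apply: (zclosure_map pu _ Cxy) => -[x2 y2] /= Bz.
by apply: sub_zclosure; exists E2', E1'.
Qed.

End PointClosure.

(** * Switching signs *)

Section SwitchedDiagrams.

Lemma rows_switch L : perm_eq (rows (syd_switch L)) (switch_rows (rows L)).
Proof. exact: rows_pi. Qed.

Lemma switch_rowsK : involutive switch_rows.
Proof. by move=> s; rewrite /switch_rows -map_comp map_id_in // => r _ /=; rewrite mapK // => b; rewrite negbK. Qed.

Lemma rows_switchV L : perm_eq (rows L) (switch_rows (rows (syd_switch L))).
Proof.
rewrite perm_sym -[X in perm_eq _ X]switch_rowsK; apply: perm_map; exact: rows_switch.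
Qed.

Lemma count_switch b s :
  [seq count_mem b r | r <- switch_rows s] = [seq count_mem (~~ b) r | r <- s].
Proof.
rewrite /switch_rows -map_comp; apply: eq_map => r /=; rewrite count_map.
by apply: eq_count => c /=; case: b; case: c.
Qed.

Lemma nb_boxes_switch b L : nb_boxes b (syd_switch L) = nb_boxes (~~ b) L.
Proof. by rewrite /nb_boxes -count_switch; apply/perm_sumn/perm_map/rows_switch. Qed.

Lemma sign_part_switch b L : sign_part b (syd_switch L) = sign_part (~~ b) L.
Proof.
rewrite /sign_part -count_switch; apply/perm_sortP.
- by move=> m n; exact: leq_total.
- by move=> m n k; rewrite /geq /= => h1 h2; exact: leq_trans h2 h1.
- by move=> m n; rewrite /geq /= andbC => /anti_leq.
- by apply/perm_filter/perm_map/rows_switch.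
Qed.

Lemma sh_sorted L : sorted geq (sh L).
Proof. by rewrite /sh /rows; case: (repr L) => s /= /andP[/andP[]]. Qed.

Lemma sh_switch L : sh (syd_switch L) = sh L.
Proof.
apply: (sorted_eq (leT := geq)); try exact: sh_sorted.
- by move=> m n k; rewrite /geq /= => h1 h2; exact: leq_trans h2 h1.
- by move=> m n; rewrite /geq /= andbC => /anti_leq.
- apply: perm_trans (perm_map size (rows_switch L)) _.
  by rewrite /switch_rows -map_comp (eq_map (g := size)) // => r /=; rewrite size_map.
Qed.

Lemma part_addC nu la : part_add nu la = part_add la nu.
Proof. by rewrite /part_add maxnC; apply: eq_map => i; rewrite addnC. Qed.

Lemma in_ASYD_switch q p L : in_ASYD q p L -> in_ASYD p q (syd_switch L).
Proof.
move=> [[Lq Lp] adm]; split; first by split; rewrite nb_boxes_switch.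
by rewrite /admissible sh_switch !sign_part_switch part_addC.
Qed.

Variable F : fieldType.
Implicit Types q p : nat.

Definition swap_vec q p (w : 'cV[F]_q * 'cV[F]_p) : 'cV[F]_p * 'cV[F]_q := (w.2, w.1).

Lemma basis_swap q p (X : seq ('cV[F]_q * 'cV[F]_p)%type) :
  basis_of fullv X -> basis_of fullv (map (@swap_vec q p) X).
Proof.
have lin : linear (@swap_vec q p) by [].
pose f : {linear _ -> _} := HB.pack (@swap_vec q p) (GRing.isLinear.Build _ _ _ _ _ lin).
have fE w : linfun f w = swap_vec w by rewrite lfunE.
move=> bX; have -> : map (@swap_vec q p) X = map (linfun f) X by apply: eq_map => w; rewrite fE.
have -> : fullv = (linfun f @: fullv)%VS.
  apply/vspaceP => -[a b]; rewrite memvf; apply/esym/memv_imgP.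
  by exists (b, a); rewrite ?memvf // fE.
apply: limg_basis_of bX; apply/eqP; rewrite -subv0; apply/subvP => -[a b] /memv_capP [_].
by rewrite memv_ker fE /swap_vec /= => /eqP [-> ->]; rewrite mem0v.
Qed.

Lemma has_diagram_swap q p (x : 'M[F]_(p, q)) (y : 'M[F]_(q, p)) L L' :
  perm_eq (rows L') (switch_rows (rows L)) ->
  has_diagram x y L -> has_diagram y x L'.
Proof.
(* Rows are those of a chosen representative, so [L'] matches the switched rows only up to a
   permutation [Is] of the indices, by which the strings are rearranged. *)
move=> /(perm_iotaP [::]) [Is Is_perm L'E] [vs [svs bas H]].
rewrite /switch_rows size_map in Is_perm.
have Is_lt i : i \in Is -> (i < size (rows L))%N.
  by rewrite (perm_mem Is_perm) mem_iota.
have stepE k v : iter k (step y x) (swap_vec v) = swap_vec (iter k (step x y) v).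
  by elim: k => //= k ->.
have rowE i : i \in Is -> nth [::] (switch_rows (rows L)) i = map negb (nth [::] (rows L) i).
  by move=> /Is_lt lt_i; rewrite (nth_map [::]).
exists [seq swap_vec (nth (0, 0) vs i) | i <- Is]; split.
- by rewrite L'E !size_map.
- have -> : strings (step y x) [seq swap_vec (nth (0, 0) vs i) | i <- Is] (sh L') =
     flatten [seq map (@swap_vec q p) (traject (step x y) (nth (0, 0) vs i) (size (nth [::] (rows L) i))) | i <- Is].
    rewrite /strings /sh L'E -map_comp zip_map -map_comp; congr flatten.
    apply/eq_in_map => i /rowE Ei /=; rewrite Ei size_map.
    move: (nth _ vs i) => v; elim: (size _) v => //= k IH v; congr (_ :: _).
    exact: IH (step x y v).
  rewrite (perm_basis _ (perm_flatten (perm_map _ Is_perm))).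
  suff -> : flatten [seq [seq swap_vec i | i <- traject (step x y) (nth (0, 0) vs i)
       (size (nth [::] (rows L) i))] | i <- iota 0 (size (rows L))] =
       map (@swap_vec q p) (strings (step x y) vs (sh L)) by exact: basis_swap.
  rewrite map_flatten -map_comp; congr flatten.
  apply: (@eq_from_nth _ [::]) => [|i].
    by rewrite !size_map size_iota size_zip size_map svs minnn.
  rewrite size_map size_iota => lt_i.
  rewrite (nth_map 0%N) ?size_iota // nth_iota // add0n.
  rewrite (nth_map ((0, 0), 0%N)) /=; last by rewrite size_zip size_map svs minnn.
  by rewrite nth_zip /= ?size_map // (nth_map [::]).
- rewrite L'E size_map => i lt_i r v.
  have iI := mem_nth 0%N lt_i; have lt_Ii := Is_lt _ iI.
  have rE : r = map negb (nth [::] (rows L) (nth 0%N Is i)).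
    by rewrite /r (nth_map 0%N) // rowE.
  have vE : v = swap_vec (nth (0, 0) vs (nth 0%N Is i)) by rewrite /v (nth_map 0%N).
  have [H1 H2] := H _ lt_Ii; rewrite rE vE size_map; split.
    by rewrite stepE H1.
  move=> j lt_j; rewrite stepE -map_rev (nth_map true) ?size_rev //.
  by have := H2 j lt_j; rewrite /homogeneous; case: (nth true _ j).
Qed.

Lemma nilcone_swap q p (x : 'M[F]_(p, q)) (y : 'M[F]_(q, p)) :
  nilcone (x, y) -> nilcone (y, x).
Proof.
move=> [k /= xy0]; exists k.+1 => /=.
have E n : (y *m x) ^+ n.+1 = y *m (x *m y) ^+ n *m x.
  elim: n => [|n IH]; first by rewrite expr1 expr0 mulmx1.
  by rewrite exprS IH -mulmxE [in RHS]exprS -mulmxE !mulmxA.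
by rewrite E xy0 mulmx0 mul0mx.
Qed.

Lemma orbit_O_switch q p (x : 'M[F]_(p, q)) (y : 'M[F]_(q, p)) L :
  orbit_O L (x, y) -> orbit_O (syd_switch L) (y, x).
Proof.
move=> [n d]; split; first exact: nilcone_swap.
exact: has_diagram_swap (rows_switch L) d.
Qed.

Lemma orbit_O_switchV q p (x : 'M[F]_(p, q)) (y : 'M[F]_(q, p)) L :
  orbit_O (syd_switch L) (y, x) -> orbit_O L (x, y).
Proof.
move=> [n d]; split; first exact: nilcone_swap.
exact: has_diagram_swap (rows_switchV L) d.
Qed.

End SwitchedDiagrams.

(** * The dual triple *)

Section FinalSteps.
Variable F : numFieldType.

(** A rank detector in moving frames. The adjugate replaces the inverse of the first frame to stay
    polynomial; the two differ by a nonzero scalar, which leaves the ranks unchanged. *)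
Lemma rank_detector_frame q p (w0 : ambient F q p) : w0.1.1 \in unitmx ->
  exists d : ambient F q p -> F, [/\ polyfun _ d, d w0 <> 0 &
    forall w, w.1.1 \in unitmx -> d w <> 0 -> forall i j, (i <= p)%N -> (j <= q)%N ->
      (\rank (corner i j (invmx w0.1.1 *m w0.2.2 *m w0.1.2))
         <= \rank (corner i j (invmx w.1.1 *m w.2.2 *m w.1.2)))%N].
Proof.
pose u (w : ambient F q p) : 'M[F]_(q, p) := \adj w.1.1 *m w.2.2 *m w.1.2.
have subV := polyfun_subalgebra (ambient F q p).
have pu : mx_in (polyfun _) u.
  have pid := @map_in_id F (ambient F q p).
  apply: mx_in_mul => //.
    apply: mx_in_mul => //; first by apply: mx_in_adj => //; apply: mx_in_map => //;
      exact: (map_in_fst subV (map_in_fst subV pid)).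
    apply: mx_in_map => //; exact: (map_in_snd subV (map_in_snd subV pid)).
  apply: mx_in_map => //; exact: (map_in_snd subV (map_in_fst subV pid)).
have uE (w : ambient F q p) i j : w.1.1 \in unitmx -> \rank (corner i j (u w)) =
    \rank (corner i j (invmx w.1.1 *m w.2.2 *m w.1.2)).
  move=> wu; rewrite /u invmx_adj // -!scalemxAl /corner -scalemxAr -scalemxAl.
  by rewrite mxrank_scale_nz // -unitfE -unitmxE.
move=> w0u; have [d [pd d0 dP]] := rank_detector (u w0).
exists (fun w => d (u w)); split=> //.
  exact: (polyfun_comp subV (map_in_mx subV pu) pd).
move=> w wu dw i j ip jq; have := dP _ dw i j ip jq.
by rewrite (uE w0 i j w0u) (uE w i j wu).
Qed.

Variables (p q : nat) (tau : 'M[bool]_(p, q)) (sigma : 'M[bool]_(q, p)).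
Hypotheses (tauP : partial_perm tau) (sigmaP : partial_perm sigma).
Variables (E0 : flag F q) (F0 : flag F p).
Hypothesis dual : is_dual E0 F0 tau sigma.

Let fibre_le := dual_fibre_le tauP dual.
Let fibre_ge := dual_fibre_ge tauP sigmaP dual.

Lemma pclosure_conormal_dual z :
  pclosure (conormal_C sigma) (swap_point z) <-> pclosure (@conormal_C F q p tau) z.
Proof.
split=> [C|]; last first.
  apply: pclosure_fibrewise => E1 E2 x y /(conormal_C_dense tauP sigmaP dual).
  by apply: zclosure_sub => w [_ Cw]; exact: sub_zclosure.
have : pclosure (conormal_C tau) (swap_point (swap_point z)).
  apply: (pclosure_fibrewise _ C) => E2 E1 y x /(conormal_C_dual_dense tauP sigmaP dual).
  have lin : linear (fun w : 'M[F]_(p, q) * 'M[F]_(q, p) => (w.2, w.1)) by [].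
  by apply: (zclosure_linear lin) => -[x1 y1] [Cw _]; exact: sub_zclosure.
by case: (z) => [[? ?] [? ?]].
Qed.

Lemma is_pr_dual L : @is_pr F q p tau L -> @is_pr F p q sigma (syd_switch L).
Proof.
move=> [[Lq Lp] prL]; split; first by split; rewrite nb_boxes_switch.
have lin m n : linear (fun w : 'M[F]_(m, n) * 'M[F]_(n, m) => (w.2, w.1)) by [].
apply/seteqP; split=> [_ [[[E2 E1] [y x]] /= C <-] | [y x] C].
  have : zclosure (@orbit_O F q p L) (x, y).
    rewrite -prL; exists ((E1, E2), (x, y)) => //.
    exact: (pclosure_conormal_dual ((E1, E2), (x, y))).1 C.
  apply: (zclosure_linear (lin _ _)) => -[x1 y1] O; apply: sub_zclosure.
  exact: orbit_O_switch.
have : zclosure (@orbit_O F q p L) (x, y).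
  apply: (zclosure_linear (lin _ _) _ C) => -[y1 x1] O; apply: sub_zclosure.
  exact: orbit_O_switchV.
rewrite -prL => -[[[E1 E2] [x1 y1]] C1 /= [xE yE]].
by exists ((E2, E1), (y, x)) => //; rewrite -xE -yE; exact: (pclosure_conormal_dual _).2 C1.
Qed.

(** * Transfer of the dense open set on which the tableaux are known *)

Section DenseOpen.
Variable A : set (Defs.point F q p).
Hypothesis openA : popen A.

(* The rank conditions cut out the locus where the cell of [x] is at least as
   large as that of [tau]. *)
Definition dual_open : set (Defs.point F p q) :=
  [set z | A (swap_point z) /\ forall i j, (i <= q)%N -> (j <= p)%N ->
     (j + ones i j tau <= \dim (img z.2.2 (z.1.2 i) + z.1.1 j)%VS)%N].

Lemma popen_dual_open : popen dual_open.
Proof.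
move=> [[E2 E1] [y x]] C [/= Az ge]; have [h [g [/= fh fg Cz]]] := C.
have nA : ~ zclosure (frames (~` A)) ((g, h), (x, y)).
  move=> Cx; suff : (~` A) ((E1, E2), (x, y)) by apply.
  by apply: openA; exists g, h.
have [f [pf f0 fz]] := notin_zclosure nA.
have [d [pd dz dP]] := @rank_detector_frame p q ((h, g), (y, x)) fh.1.
have subV := polyfun_subalgebra (ambient F p q).
have lin := @swap_ambient_linear F p q.
have pfs : polyfun (ambient F p q) (fun w => f (swap_ambient w)).
  exact: (polyfun_comp subV (map_in_linear subV lin (@map_in_id F _)) pf).
(* At a frame of the complement one of the two factors vanishes: [f] off its zeros certifies
   membership in [A], and [d] the rank conditions. The product is nonzero at the given point, so the
   latter is not in the closure. *)
have := polyfun_zclosure (sub_mul subV pfs pd) Cz.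
have nz : f (swap_ambient ((h, g), (y, x))) * d ((h, g), (y, x)) <> 0.
  by apply/eqP; rewrite mulf_neq0 //; apply/eqP.
move=> H; apply: nz; apply: H => -[[h1 g1] [y1 x1]] [E2' [E1' [/= fh1 fg1 nD]]].
apply/eqP; rewrite mulf_eq0; apply/norP => -[/eqP fw /eqP dw].
apply: nD; split=> /=.
  apply: contrapT => nA1; apply: fw; apply: f0; exists E1', E2'; split=> //.
move=> i j iq jp; rewrite (dim_schubert _ _ fg1 fh1) // leq_add2l.
apply: leq_trans _ (dP ((h1, g1), (y1, x1)) fh1.1 dw i j iq jp) => /=.
by have := ge i j iq jp; rewrite (dim_schubert _ _ fg fh) // leq_add2l.
Qed.

(** By [dual_conormal_sub], [x] lies in the closure of the cell of tau; the rank conditions in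
    [dual_open] are what puts it in the cell itself. *)
Lemma dual_open_conormal E1 E2 x y :
  conormal_C sigma ((E2, E1), (y, x)) -> dual_open ((E2, E1), (y, x)) ->
  conormal_C tau ((E1, E2), (x, y)).
Proof.
have [g fg] := frame_exists E1; have [h fh] := frame_exists E2.
move=> /(conormal_CP fh fg) Z [/= _ ge]; apply/(conormal_CP fg fh).
have [/= Sy yx xy] := Z; split=> //=; apply: zclosure_schub_ge.
  have := dual_conormal_sub tauP sigmaP fibre_le fibre_ge Z.
  have lin : linear (fun w : 'M[F]_(p, q) * 'M[F]_(q, p) => w.1) by [].
  by apply: (zclosure_linear lin) => -[x1 y1] [/= Sx _ _]; exact: sub_zclosure.
by move=> i j iq jp; have := ge i j iq jp; rewrite (dim_schubert _ _ fg fh) // leq_add2l.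
Qed.

Lemma dual_open_dense :
  conormal_C tau `<=` pclosure (@conormal_C F q p tau `&` A) ->
  conormal_C sigma `<=` pclosure (@conormal_C F p q sigma `&` dual_open).
Proof.
move=> densA [[E2 E1] [y x]] Cz.
have [g fg] := frame_exists E1; have [h fh] := frame_exists E2.
exists h, g; split=> //=; apply/zclosureP => f pf f0; apply: contrapT => fz.
pose V := ('M[F]_(p, q) * 'M[F]_(q, p))%type.
have subV := polyfun_subalgebra V.
pose f1 (w : V) := f ((h, g), (w.2, w.1)).
have pf1 : polyfun V f1.
  apply: (polyfun_comp subV _ pf); apply: map_in_pair => //; first exact: map_in_cst.
  have lin : linear (fun z : V => (z.2, z.1)) by [].
  exact: (map_in_linear subV lin (@map_in_id _ _)).
(* Density within the fibre over the fixed flags replaces the given point by one common to both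
   bundles where [f] is still nonzero. *)
have [[x1 y1] [C1 C1'] f1z] : exists2 w, conormal_both tau sigma E1 E2 w & f1 w <> 0.
  apply: contrapT => nw; apply: fz.
  rewrite -[LHS]/(f1 (x, y)); apply: (polyfun_zclosure pf1 (conormal_C_dual_dense tauP sigmaP dual Cz)).
  by move=> w Cw; apply: contrapT => fw; apply: nw; exists w.
have CU := pclosure_frames (densA _ C1) fg fh.
have subW := polyfun_subalgebra (ambient F q p).
(* The approximating points of Z_C(tau) in [A] have varying flags; where [d] does not vanish, their
   [y] is in the cell of sigma, so their exchange is in Z_C(sigma). *)
have [d [pd dz dP]] := @rank_detector_frame q p ((g, h), (x1, y1)) fg.1.
have pfs : polyfun (ambient F q p) (fun w => f (swap_ambient w)).
  exact: (polyfun_comp subW (map_in_linear subW (@swap_ambient_linear F q p) (@map_in_id F _)) pf).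
have nz : f (swap_ambient ((g, h), (x1, y1))) * d ((g, h), (x1, y1)) <> 0.
  by apply/eqP; rewrite mulf_neq0 //; apply/eqP.
apply: nz; apply: (polyfun_zclosure (sub_mul subW pfs pd) CU).
move=> [[g2 h2] [x2 y2]] [E1' [E2' [/= fg2 fh2 [Cu Au]]]].
apply/eqP; rewrite mulf_eq0; apply/norP => -[/eqP fw /eqP dw].
apply: fw; apply: f0; exists E2', E1'; split=> //=.
have Z := (conormal_CP fg2 fh2 _ _ _).1 Cu; have [/= Sx xy yx] := Z.
have [/= Sy1 _ _] := (conormal_CP fh fg _ _ _).1 C1'.
split.
  apply/(conormal_CP fh2 fg2); split=> //=; apply: zclosure_schub_ge (fibre_le Z) _.
  by move=> i j ip jq; rewrite -(Sy1 i j ip jq); exact: (dP ((g2, h2), (x2, y2)) fg2.1 dw i j ip jq).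
split=> //= i j iq jp.
by rewrite (dim_schubert _ _ fg2 fh2) // Sx.
Qed.

End DenseOpen.

Lemma corresponds_dual L Q P :
  corresponds F tau L Q P -> corresponds F sigma (syd_switch L) P Q.
Proof.
move=> [asyd sytQ sytP pr [U [[A openA UE] densU] tabU]]; split.
- exact: in_ASYD_switch.
- by rewrite sign_part_switch.
- by rewrite sign_part_switch.
- exact: is_pr_dual.
(* Exchanging the factors sends this set into [U], where the Jordan types of the restrictions of
   [y *m x] and [x *m y] are known; the two tableaux trade places with the flags. *)
exists (@conormal_C F p q sigma `&` dual_open A).
  split; first by exists (dual_open A) => //; exact: popen_dual_open.
  by apply: dual_open_dense; rewrite -UE.
move=> E2 E1 y x [Cz Dz].
have [] := tabU E1 E2 x y; last by [].
by rewrite UE; split; [exact: dual_open_conormal Cz Dz | case: Dz].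
Qed.

End FinalSteps.

Theorem proposition7p3 (R : realType) (p q : nat) (hp : (0 < p)%N)
  (hq : (0 < q)%N)
  (tau : 'M[bool]_(p, q)) (htau : partial_perm tau)
  (E : flag R[i] q) (F : flag R[i] p)
  (tau_dual : 'M[bool]_(q, p)) (htau_dual : partial_perm tau_dual)
  (hdual : is_dual E F tau tau_dual)
  (L : signed_diagram) (Q P : seq (seq nat))
  (hcorr : corresponds R[i] tau L Q P) :
  corresponds R[i] tau_dual (syd_switch L) P Q.
Proof.
exact: (@corresponds_dual (R[i] : numFieldType) p q tau tau_dual htau htau_dual E F
  hdual L Q P hcorr).
Qed.
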